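(* Let $E$ be a locally complete locally convex Hausdorff space over $\mathbb{C}$, $\Omega\subset\mathbb{C}^{d}$ open, $w\in\Omega$, $R\in(0,\infty]^{d}$ with $\mathbb{D}_R(w)\subset\Omega$ and let $f\colon\Omega\to E$ be holomorphic. Then \[ (\partial^{\beta}_{\mathbb{C}})f(\zeta)=\frac{\beta!}{(2\pi i)^{d}}\int_{\partial_0\mathbb{D}_\rho(w)}\frac{f(z)}{(z-\zeta)^{\beta+(1,\dots,1)}}\,\mathrm{d}z\in E,\qquad \zeta\in\mathbb{D}_\rho(w),\ \beta\in\mathbb{N}_0^{d}, \] for all $\rho\in(0,\infty)^{d}$ with $\rho<R$ (in particular the derivatives exist in $E$ and the integrals exist as Pettis-integrals with value in $E$).
   Context: $E$ is a non-trivial locally convex Hausdorff space with completion $\widehat{E}$ and dual $E'$. For a bounded, absolutely convex set (disk) $D\subset E$ put $E_D:=\bigcup_{n\in\mathbb{N}}nD$ normed by the gauge of $D$; $E$ is locally complete if $E_D$ is a Banach space for every closed disk $D$. $f\colon\Omega\to E$ is holomorphic if for every $z\in\Omega$ there is a $\mathbb{C}$-linear map $df(z)\colon\mathbb{C}^d\to\widehat{E}$ with $\lim_{w\to z,\,w\in\Omega,\,w\ne z}\frac{f(w)-f(z)-df(z)[w-z]}{|w-z|}=0$ in $\widehat{E}$, and $df(\cdot)[v]\colon\Omega\to\widehat{E}$ is continuous for every $v\in\mathbb{C}^d$. $\partial^{e_j}_{\mathbb{C}}f(z):=\lim_{h\to0,\,h\in\mathbb{C}\setminus\{0\}}\frac{f(z+he_j)-f(z)}{h}$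 (limit in $E$), and $\partial^{\beta}_{\mathbb{C}}f:=(\partial^{\beta_1}_{\mathbb{C}})\cdots(\partial^{\beta_d}_{\mathbb{C}})f$, where $\partial^{\beta_j}_{\mathbb{C}}$ is the $\beta_j$-fold iterate of $\partial^{e_j}_{\mathbb{C}}$. $\beta!=\prod_j\beta_j!$ and $(z-\zeta)^{\beta}=\prod_j(z_j-\zeta_j)^{\beta_j}$. $\mathbb{D}_R(w)=\prod_{k=1}^d\{\zeta\in\mathbb{C}:|\zeta-w_k|<R_k\}$, $\partial_0\mathbb{D}_\rho(w)=\prod_{k=1}^d\{\zeta\in\mathbb{C}:|\zeta-w_k|=\rho_k\}$; $\rho<R$ means $\rho_k<R_k$ for all $k$. For an $E$-valued function $g$ defined on a set containing $\partial_0\mathbb{D}_\rho(w)$, \[ \int_{\partial_0\mathbb{D}_\rho(w)}g(z)\,\mathrm{d}z:=\int_{[0,2\pi]^d}g(\gamma(t))\prod_{k=1}^d\gamma_k'(t_k)\,\mathrm{d}t,\qquad \gamma_k(t_k)=w_k+\rho_ke^{it_k},\ \gamma(t)=(\gamma_1(t_1),\dots,\gamma_d(t_d)), \] as a Pettis-integral: the Pettis-integral of $h\colon\Lambda\to E$ over a Lebesgue measurable set $\Lambda\subset\mathbb{R}^d$ is the (unique) element $e_\Lambda(h)\in E$ with $\langle e',e_\Lambda(h)\rangle=\int_\Lambda\langle e',h(x)\rangle\,\mathrm{d}x$ for all $e'\in E'$, where all $e'\circ h$ are required to be Lebesgue integrable on $\Lambda$. *)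

(* Defs.v *)
From HB Require Import structures.
From mathcomp Require Import all_boot all_order all_algebra.
From mathcomp Require Import all_classical all_reals all_analysis.
From mathcomp Require Import complex.
Import Order.TTheory GRing.Theory Num.Theory.
Import numFieldNormedType.Exports.

Set Implicit Arguments.
Unset Strict Implicit.
Unset Printing Implicit Defensive.

Local Open Scope classical_set_scope.
Local Open Scope ring_scope.
Local Open Scope complex_scope.

(* The libraries put the norm topology on R[i]^o only. *)
HB.instance Definition _ (R : realType) := NormedModule.copy R[i] R[i]^o.

Section LocallyConvex.
Context {R : realType}.
Implicit Types E F : tvsType R[i].

(* Completeness is phrased with the neighbourhoods of 0, not with the
   entourages of E: [tvsType] does not require the uniform structure to be the
   translation-invariant one. *)
Definition tvs_complete E : Prop :=
  forall G : set_system E, ProperFilter G ->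
    (forall U : set E, nbhs 0 U -> \forall x & y \near G, U (x - y)) ->
    exists l : E, G --> l.

Definition tvs_embedding E F (iota : {linear E -> F}) : Prop :=
  injective iota /\
  forall U : set E,
    nbhs 0 U <-> exists2 V : set F, nbhs 0 V & iota @^-1` V `<=` U.

Definition is_completion E F (iota : {linear E -> F}) : Prop :=
  [/\ hausdorff_space F, tvs_complete F, tvs_embedding iota &
      closure (range iota) = setT].

Definition tvs_bounded E (D : set E) : Prop :=
  forall U : set E, nbhs 0 U ->
    exists2 r : R, 0 < r & D `<=` [set r%:C *: x | x in U].

Definition absolutely_convex E (D : set E) : Prop :=
  D !=set0 /\
  forall (x y : E) (a b : R[i]),
    D x -> D y -> `|a| + `|b| <= 1 -> D (a *: x + b *: y).

Definition disk E (D : set E) : Prop := tvs_bounded D /\ absolutely_convex D.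

Definition disk_span E (D : set E) : set E :=
  \bigcup_(n in [set n : nat | (0 < n)%N]) [set n%:R *: x | x in D].

Definition gauge E (D : set E) (x : E) : R :=
  inf [set t : R | 0 < t /\ exists2 y, D y & x = t%:C *: y].

(* Only completeness has to be required for [disk_span D] to be a Banach space:
   the gauge of a disk of a Hausdorff space is a norm. *)
Definition banach_disk E (D : set E) : Prop :=
  forall u : nat -> E, (forall n, disk_span D (u n)) ->
    (forall e : R, 0 < e -> \forall m & n \near \oo, gauge D (u m - u n) < e) ->
    exists2 l : E, disk_span D l & gauge D (u n - l) @[n --> \oo] --> (0 : R).

Definition locally_complete E : Prop :=
  forall D : set E, disk D -> closed D -> banach_disk D.

End LocallyConvex.

Section Holomorphy.
Context {R : realType} {d : nat}.
Local Notation Cd := 'rV[R[i]]_d.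

Definition eucl_norm (z : Cd) : R :=
  Num.sqrt (\sum_(k < d) Normc.normc (z 0 k) ^+ 2).

(* f : Omega -> E is represented by a total function whose values outside of
   Omega are irrelevant; iota embeds E into its completion F. *)
Definition holomorphic (E F : tvsType R[i]) (iota : {linear E -> F})
    (Omega : set Cd) (f : Cd -> E) : Prop :=
  exists df : Cd -> {linear Cd -> F},
    (forall z, Omega z ->
      ((eucl_norm (u - z))^-1%:C *: (iota (f u) - iota (f z) - df z (u - z)))
        @[u --> within Omega z^'] --> (0 : F)) /\
    (forall v : Cd, {within Omega, continuous (fun z => df z v)}).

Section Derivatives.
Variable E : tvsType R[i].
Implicit Types (f : Cd -> E) (z : Cd) (j : 'I_d).

Definition is_cpartial f j z (l : E) : Prop :=
  h^-1 *: (f (z + h *: delta_mx 0 j) - f z) @[h --> (0 : R[i])^'] --> l.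

(* 0 where the limit does not exist *)
Definition cpartial f j z : E := xget 0 [set l | is_cpartial f j z l].

(* The directions are listed outermost first. *)
Definition cpartials f (s : seq 'I_d) : Cd -> E :=
  foldr (fun j g => cpartial g j) f s.

Fixpoint cpartials_exist f (s : seq 'I_d) (D : set Cd) : Prop :=
  if s is j :: s' then
    cpartials_exist f s' D /\
    forall z, D z -> exists l, is_cpartial (cpartials f s') j z l
  else True.

(* beta_0 times direction 0, ..., beta_(d-1) times direction d-1 *)
Definition mindex_dirs (beta : 'I_d -> nat) : seq 'I_d :=
  flatten [seq nseq (beta j) j | j <- enum 'I_d].

Definition cderiv (beta : 'I_d -> nat) f : Cd -> E :=
  cpartials f (mindex_dirs beta).

Definition cderiv_exists (beta : 'I_d -> nat) f (D : set Cd) : Prop :=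
  cpartials_exist f (mindex_dirs beta) D.

End Derivatives.

Definition mpower (z : Cd) (beta : 'I_d -> nat) : R[i] :=
  \prod_(k < d) z 0 k ^+ beta k.

Definition polydisc (w : Cd) (r : 'I_d -> \bar R) : set Cd :=
  [set z | forall k, ((Normc.normc (z 0 k - w 0 k))%:E < r k)%E].

End Holomorphy.

Section TupleMeasure.
Context {disp : measure_display} {T : measurableType disp} {R : realType}.

Definition cons_pair n (xt : T * n.-tuple T) : n.+1.-tuple T :=
  [tuple of xt.1 :: xt.2].

Lemma measurable_cons_pair n : measurable_fun setT (@cons_pair n).
Proof. exact: measurable_cons. Qed.

Section cons_measure.
Variables (m : {sigma_finite_measure set T -> \bar R}) (n : nat).
Variable mu : {sigma_finite_measure set (n.-tuple T) -> \bar R}.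

Definition cons_measure : set (n.+1.-tuple T) -> \bar R :=
  pushforward (m \x mu)%E (@cons_pair n).

HB.instance Definition _ := Measure.copy cons_measure
  (@measure_function_pushforward__canonical__measure_function_Measure
    _ _ _ _ _ _ _ (@measurable_cons_pair n)).

Let cons_measure_sigma_finite : sigma_finite setT cons_measure.
Proof.
have [[F FT mF]] :=
  lebesgue_integral_fubini.measure_function_Measure_isSigmaFinite__to__measure_function_isSigmaFinite
    m mu.
pose g (t : n.+1.-tuple T) : T * n.-tuple T :=
  (tnth t ord0, [tuple of behead t]).
have mg : measurable_fun setT g.
  by apply/measurable_fun_pair => //;
    [exact: measurable_tnth | exact: measurable_behead].
have gK : cancel (@cons_pair n) g.
  by case=> x t; rewrite /g /cons_pair /=; congr pair; apply/val_inj.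
exists (fun k => g @^-1` F k) => [|k].
  by rewrite -preimage_bigcup -FT preimage_setT.
have [mFk Fkoo] := mF k; split.
  by rewrite -[X in measurable X]setTI; exact: mg.
rewrite /cons_measure /pushforward -comp_preimage (_ : g \o _ = id).
  by rewrite preimage_id.
exact/funext.
Qed.

HB.instance Definition _ := @Measure_isSigmaFinite.Build _ _ _ cons_measure
  cons_measure_sigma_finite.

End cons_measure.

Fixpoint tuple_measure (m : {sigma_finite_measure set T -> \bar R}) n :
    {sigma_finite_measure set (n.-tuple T) -> \bar R} :=
  match n return {sigma_finite_measure set (n.-tuple T) -> \bar R} with
  | 0 => dirac ([tuple] : 0.-tuple T)
  | n'.+1 => cons_measure m (tuple_measure m n')
  end.

Lemma tuple_measure_box (m : {sigma_finite_measure set T -> \bar R}) n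
    (A : 'I_n -> set T) : (forall i, measurable (A i)) ->
  tuple_measure m n [set t | forall i, A i (tnth t i)] = (\prod_(i < n) m (A i))%E.
Proof.
elim: n A => [|n IHn] A mA.
  by rewrite big_ord0 /= diracE mem_set//= => -[].
have mbox : measurable [set t : n.-tuple T | forall i, A (lift ord0 i) (tnth t i)].
  rewrite (_ : mkset _ = \bigcap_(i in [set: 'I_n])
    ((fun t : n.-tuple T => tnth t i) @^-1` A (lift ord0 i))); last first.
    by apply/seteqP; split => [t At i _|t At i]; [exact: At|exact: (At i)].
  apply: fin_bigcap_measurable => // i _.
  by rewrite -[X in measurable X]setTI; exact: measurable_tnth.
rewrite big_ord_recl -(IHn (fun i => A (lift ord0 i)))//.
rewrite -product_measure1E//= /cons_measure /pushforward; congr product_measure1.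
apply/seteqP; split => [[x t] /= At|[x t] /= [Ax At] i].
  by split=> [|i]; [exact: (At ord0) | have := At (lift ord0 i); rewrite tnthS].
by case: (unliftP ord0 i) => [j ->|->]; rewrite ?tnthS ?tnth0//; exact: At.
Qed.

End TupleMeasure.

(* Lebesgue measure on R^d, on the Borel sets (the product sigma-algebra). *)
Definition lebesgue_tuple {R : realType} (d : nat) :
    {sigma_finite_measure set (d.-tuple (measurableTypeR R)) -> \bar R} :=
  tuple_measure (@lebesgue_measure R) d.

Section PettisIntegral.
Context {disp : measure_display} {T : measurableType disp} {R : realType}.
Variable mu : {measure set T -> \bar R}.

Definition cintegrable (D : set T) (g : T -> R[i]) : Prop :=
  mu.-integrable D (EFin \o (@complex.Re R \o g)) /\
  mu.-integrable D (EFin \o (@complex.Im R \o g)).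

Definition cintegral (D : set T) (g : T -> R[i]) : R[i] :=
  (\int[mu]_(x in D) complex.Re (g x))%R +i*
  (\int[mu]_(x in D) complex.Im (g x))%R.

(* [{scalar E}] is the type of linear functionals on E. *)
Definition is_pettis_integral (E : tvsType R[i]) (D : set T) (h : T -> E)
    (e : E) : Prop :=
  forall phi : {scalar E}, continuous phi ->
    cintegrable D (phi \o h) /\ phi e = cintegral D (phi \o h).

End PettisIntegral.

Section TorusIntegral.
Context {R : realType} {d : nat}.
Local Notation Cd := 'rV[R[i]]_d.

Definition circle_path (a : R[i]) (r t : R) : R[i] :=
  a + r%:C * (cos t +i* sin t).

Definition cderive1 (g : R -> R[i]) (t : R) : R[i] :=
  derive1 (@complex.Re R \o g) t +i* derive1 (@complex.Im R \o g) t.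

Definition torus_path (w : Cd) (rho : 'I_d -> R) (t : d.-tuple R) : Cd :=
  \row_k circle_path (w 0 k) (rho k) (tnth t k).

Definition is_torus_integral (E : tvsType R[i]) (w : Cd) (rho : 'I_d -> R)
    (g : Cd -> E) (e : E) : Prop :=
  is_pettis_integral (lebesgue_tuple d)
    [set t | forall k, 0 <= (tnth t k : R) <= 2 * pi]
    (fun t => (\prod_(k < d) cderive1 (circle_path (w 0 k) (rho k)) (tnth t k))
              *: g (torus_path w rho t))
    e.

End TorusIntegral.

(* Main.v *)
Require Import Defs.
From HB Require Import structures.
From mathcomp Require Import all_boot all_order all_algebra.
From mathcomp Require Import all_classical all_reals all_analysis.
From mathcomp Require Import measurable_realfun complex ring lra.
Import Order.TTheory GRing.Theory Num.Theory.
Import numFieldNormedType.Exports.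

Set Implicit Arguments.
Unset Strict Implicit.
Unset Printing Implicit Defensive.

Local Open Scope classical_set_scope.
Local Open Scope ring_scope.
Local Open Scope complex_scope.

(** Why the formula holds, and why everything stays in the space itself.

Composed with a continuous functional phi, f becomes a scalar function of d
complex variables with continuous partial derivatives, so Cauchy's formula
holds for it ([cauchy_formula]).  The one-variable formula [cauchy_disc] comes
from the invariance of a circle integral along a homotopy
([cintegral_homotopy]), and [cauchy_polydisc] iterates it with Fubini's
theorem.

The derivatives are then reached one direction at a time
([cauchy_formula_cpartial]).  Suppose that phi o g is the torus integral of
phi o f against some kernel depending on z.  A difference quotient of g is,
under phi, the torus integral of phi o f against the difference quotient of
the kernel, and the latter is within K |h| of the derivative of the kernel,
uniformly on the torus ([torus_kernel_quotient]).  Hence, if |phi| <= c on the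
bounded set B = f(torus), then the quotients for h and k differ under phi by
at most K' (|h| + |k|) c, with K' independent of phi.  This says that they
differ by an element of K' (|h| + |k|) times the bipolar of B, that is, they
form a Mackey-Cauchy family.  The bipolar of B is a closed disk; it is bounded
by the Hahn-Banach theorem ([bipolar_bounded]).  Local completeness therefore
gives a limit in the space itself ([mackey_limit]): the partial derivative of
g exists and satisfies, under each phi, the formula with the differentiated
kernel.

No vector-valued integral has to be constructed.  The formula just described
says that the derivative, divided by beta! / (2 pi i)^d, has under each phi
the value required of the Pettis integral, so this quotient is the Pettis
integral.

The derivative df of a holomorphic function takes its values in the
completion, on which phi is not defined.  What phi needs is that difference
quotients of f at nearby points are eventually close in the space
([near_diff_quotient]); this gives both the existence and the continuity of
the partial derivatives of phi o f ([weak_partial]). *)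

(** * Sublinear functionals and the Hahn-Banach theorem *)

Section HahnBanach.
Context {R : realType} {E : lmodType R[i]}.
Implicit Types (q p : E -> R) (x y : E).

Definition sublinear q : Prop :=
  (forall x y, q (x + y) <= q x + q y) /\
  (forall (r : R) x, 0 < r -> q (r%:C *: x) <= r * q x).

Lemma sublinearZ q (r : R) x : sublinear q -> 0 <= r -> q (r%:C *: x) = r * q x.
Proof.
move=> [_ qZ]; have q0 : q 0 = 0.
  have := qZ 2 0 (ltr0Sn _ _); have := qZ 2^-1 0; rewrite !scaler0 invr_gt0 ltr0Sn.
  by move=> /(_ isT); lra.
rewrite le_eqVlt => /orP[/eqP <-|r0]; first by rewrite scale0r q0 mul0r.
apply/le_anti; rewrite qZ//= -ler_pdivlMl// -{1}(scale1r x).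
rewrite (_ : 1 = (r^-1)%:C * r%:C); last first.
  by rewrite -rmorphM/= mulVf ?gt_eqF.
by rewrite -scalerA qZ// invr_gt0.
Qed.

Lemma sublinearN q x : sublinear q -> - q (- x) <= q x.
Proof.
move=> sq; rewrite -subr_ge0 opprK; have := sq.1 x (- x).
by rewrite subrr -(scale0r x) sublinearZ// mul0r.
Qed.

(** The largest sublinear functional below q whose value at -y is at most
- q y: a sublinear functional below q that is linear on the line through y
and agrees with q at y lies below it. *)
Definition tilt q y x : R := inf [set q (x + t%:C *: y) - t * q y | t in [set t : R | 0 <= t]].

Lemma tilt_le q y x (t : R) : sublinear q -> 0 <= t ->
  tilt q y x <= q (x + t%:C *: y) - t * q y.
Proof.
move=> sq t0; apply: ge_inf; last by exists t.
exists (- q (- x)) => _ [s s0 <-]; rewrite -sublinearZ//.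
by have := sq.1 (- x) (x + s%:C *: y); rewrite addKr; lra.
Qed.

Lemma le_tilt q y x (c : R) :
  (forall t : R, 0 <= t -> c <= q (x + t%:C *: y) - t * q y) -> c <= tilt q y x.
Proof.
move=> h; apply: lb_le_inf => [|_ [t t0 <-]]; last exact: h.
by exists (q (x + 0%:C *: y) - 0 * q y), 0 => //=.
Qed.

Lemma tilt_sublinear q y : sublinear q -> sublinear (tilt q y).
Proof.
move=> sq; split => [x x'|r x r0].
- rewrite -lerBlDl; apply: le_tilt => t t0; rewrite lerBlDl -lerBlDr.
  apply: le_tilt => s s0; rewrite lerBlDr.
  apply: le_trans (tilt_le _ _ sq (addr_ge0 s0 t0)) _.
  have := sq.1 (x + s%:C *: y) (x' + t%:C *: y).
  rewrite addrACA -scalerDl -rmorphD/=; lra.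
- rewrite mulrC -ler_pdivrMr//; apply: le_tilt => t t0.
  rewrite ler_pdivrMr//.
  apply: le_trans (tilt_le _ _ sq (mulr_ge0 (ltW r0) t0)) _.
  rewrite rmorphM/= -scalerA -scalerDr sublinearZ//; last exact: ltW.
  by rewrite mulrBl -mulrA [r * q _]mulrC [r * (t * _)]mulrC.
Qed.

(** Zorn's lemma applies because the pointwise infimum of a chain of sublinear
functionals below p is finite: each of them is at least - p (- x) at x. *)
Lemma minimal_sublinear p : sublinear p -> exists q, [/\ sublinear q,
  forall x, q x <= p x &
  forall q', sublinear q' -> (forall x, q' x <= q x) -> forall x, q x <= q' x].
Proof.
move=> sp; pose T := {q : E -> R | sublinear q /\ forall x, q x <= p x}.
pose r (a b : T) := `[< forall x, sval b x <= sval a x >].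
have [|||[q [sq qp]] qm] := @ZL_preorder T (exist _ p (conj sp (fun=> lexx _))) r.
- by move=> t; apply/asboolP.
- by move=> a b c /asboolP ab /asboolP bc; apply/asboolP => x; exact: le_trans (ab x).
- move=> A totA.
  have [[a0 Aa0]|A0] := pselect (exists a, A a); last first.
    exists (exist _ p (conj sp (fun=> lexx _))) => s As.
    by exfalso; apply: A0; exists s.
  pose m x := inf [set sval s x | s in A].
  have m_le s x : A s -> m x <= sval s x.
    move=> As; apply: ge_inf; last by exists s.
    exists (- p (- x)) => _ [u Au <-].
    case: u {Au} => u [su up] /=; have := sublinearN x su; have := up (- x); lra.
  have m_ge x c : (forall s, A s -> c <= sval s x) -> c <= m x.
    move=> h; apply: lb_le_inf => [|_ [s As <-]]; last exact: h.
    by exists (sval a0 x), a0.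
  have sm : sublinear m.
    split => [x x'|t x t0].
    + rewrite -lerBlDl; apply: (m_ge) => s As; rewrite lerBlDl -lerBlDr.
      apply: (m_ge) => u Au; rewrite lerBlDr.
      case: (totA _ _ As Au) => /asboolP su.
      * apply: le_trans (m_le _ _ Au) _; case: u Au su => u [hu up] Au /= su.
        by have := hu.1 x x'; have := su x'; lra.
      * apply: le_trans (m_le _ _ As) _; case: s As su => s [hs sp'] As /= su.
        by have := hs.1 x x'; have := su x; lra.
    + rewrite mulrC -ler_pdivrMr//; apply: (m_ge) => s As; rewrite ler_pdivrMr//.
      apply: le_trans (m_le _ _ As) _; rewrite mulrC.
      by case: s As => s [hs ?] As /=; exact: hs.2.
  have mp x : m x <= p x.
    by apply: le_trans (m_le _ _ Aa0) _; case: (a0) => ? [].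
  by exists (exist _ m (conj sm mp)) => s As; apply/asboolP => x /=; exact: m_le.
- exists q; split => // q' sq' q'q x.
  have q'p y : q' y <= p y by exact: le_trans (qp y).
  have /(_ _)/asboolP := qm (exist _ q' (conj sq' q'p)); apply.
  exact/asboolP.
Qed.

(** A minimal sublinear functional is additive, since no tilt can lower it.
Minimising below the tilt of p at x0, instead of below p, forces the value
p x0 at x0, since it bounds the value at - x0 by - p x0. *)
Lemma hahn_banach p x0 : sublinear p -> exists u : E -> R,
  [/\ forall x y, u (x + y) = u x + u y,
      forall (r : R) x, u (r%:C *: x) = r * u x,
      forall x, u x <= p x & u x0 = p x0].
Proof.
move=> sp; have [u [su uq um]] := minimal_sublinear (tilt_sublinear x0 sp).
(* tilting a minimal functional in any direction leaves it unchanged *)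
have uD x y : u (x + y) = u x + u y.
  apply/le_anti; rewrite su.1 -lerBrDr /=.
  have tu z : tilt u y z <= u z.
    by have := tilt_le y z su (lexx 0); rewrite scale0r addr0 mul0r subr0.
  apply: le_trans (um _ (tilt_sublinear y su) tu x) _.
  by have := tilt_le y x su ler01; rewrite scale1r mul1r.
have uN x : u (- x) = - u x.
  by have := uD x (- x); rewrite subrr -(scale0r x) sublinearZ// mul0r; lra.
have up x : u x <= p x.
  apply: le_trans (uq x) _.
  by have := tilt_le x0 x sp (lexx 0); rewrite scale0r addr0 mul0r subr0.
exists u; split => //.
- move=> r x; have [r0|r0] := leP 0 r; first exact: sublinearZ.
  rewrite -[r]opprK rmorphN/= scaleNr uN sublinearZ// ?mulNr//; lra.
- apply/le_anti; rewrite up/= -[u x0]opprK lerNr -uN.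
  apply: le_trans (uq _) _; have := tilt_le x0 (- x0) sp ler01.
  by rewrite scale1r addNr mul1r -[in p 0](scale0r x0) sublinearZ// mul0r sub0r.
Qed.

End HahnBanach.

(** * The modulus of complex numbers *)

Section ComplexModulus.
Context {R : realType}.
Local Notation C := R[i].
Local Notation nc := (@Normc.normc R).
Implicit Types (a b z : C) (r : R).

Lemma normr_normc z : `|z| = (nc z)%:C.
Proof. by []. Qed.

Lemma normc_ge0 z : 0 <= nc z.
Proof. by rewrite -lecR -normr_normc normr_ge0. Qed.

Lemma normcR r : nc r%:C = `|r|.
Proof. by rewrite /Normc.normc /= expr0n/= addr0 sqrtr_sqr. Qed.

Lemma normc_eq0 z : (nc z == 0) = (z == 0).
Proof.
by apply/eqP/eqP => [/Normc.eq0_normc//|->]; rewrite Normc.normc0.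
Qed.

Lemma normc_gt0 z : (0 < nc z) = (z != 0).
Proof. by rewrite lt_def normc_eq0 normc_ge0 andbT. Qed.

Lemma normcB a b : nc (a - b) = nc (b - a).
Proof. by rewrite -opprB normcN. Qed.

Lemma le_normcB a b : nc (a - b) <= nc a + nc b.
Proof. by rewrite -(normcN b) le_normcD. Qed.

Lemma normc_Re z : `|complex.Re z| <= nc z.
Proof. by rewrite -lecR; exact: normc_ge_Re. Qed.

Lemma normc_Im z : `|complex.Im z| <= nc z.
Proof.
case: z => a b /=; rewrite -sqrtr_sqr ler_wsqrtr// lerDr; exact: sqr_ge0.
Qed.

Lemma normc_le_ReIm z : nc z <= `|complex.Re z| + `|complex.Im z|.
Proof.
case: z => a b /=; rewrite -[leRHS]ger0_norm ?addr_ge0// -sqrtr_sqr ler_wsqrtr//.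
rewrite sqrrD !real_normK ?num_real//.
by rewrite addrAC lerDl mulrn_wge0// mulr_ge0.
Qed.

Lemma normcX z n : nc (z ^+ n) = nc z ^+ n.
Proof.
by elim: n => [|n IH]; rewrite ?expr0 ?Normc.normc1// !exprS Normc.normcM IH.
Qed.

Lemma cvg_normcP {T : Type} (F : set_system T) {FF : Filter F} (f : T -> C) (l : C) :
  f @ F --> l <-> forall e : R, 0 < e -> \forall x \near F, nc (f x - l) < e.
Proof.
split => [/cvgrPdist_lt fl e e0|h].
  have /fl : 0 < e%:C :> C by rewrite ltcR.
  by apply: filterS => x; rewrite normr_normc ltcR normcB.
apply/cvgrPdist_lt => -[e e'] /=; rewrite ltcE/= => /andP[/eqP -> e0].
by apply: filterS (h _ e0) => x; rewrite normr_normc normcB -ltcR.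
Qed.

Lemma nbhs_normcP z (U : set C) :
  nbhs z U <-> exists2 e : R, 0 < e & forall x, nc (x - z) < e -> U x.
Proof.
split => [/nbhs_ballP[[e e'] /=]|[e e0 eU]].
  rewrite ltcE/= => /andP[/eqP -> e0] eU; exists e => // x xe; apply: eU.
  by rewrite -ball_normE/= normr_normc ltcR normcB.
apply/nbhs_ballP; exists e%:C; first by rewrite /= ltcR.
by move=> x; rewrite -ball_normE/= normr_normc ltcR normcB; exact: eU.
Qed.

Lemma dnbhs_normcP (P : set C) :
  (\forall h \near (0 : C)^', P h) <->
  exists2 e : R, 0 < e & forall h, h != 0 -> nc h < e -> P h.
Proof.
split => [/nbhs_normcP[e e0 eP]|[e e0 eP]].
  by exists e => // h h0 he; apply: eP => //; rewrite subr0.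
by apply/nbhs_normcP; exists e => // x /=; rewrite subr0 => xe x0; exact: eP.
Qed.

End ComplexModulus.

(** * Gauges and functionals on locally convex spaces *)

Section LocallyConvexSpaces.
Context {R : realType} {E : tvsType R[i]}.
Local Notation C := R[i].
Local Notation nc := (@Normc.normc R).
Implicit Types (U W D B : set E) (x y : E).

Lemma cvg_tvsP {T : Type} (F : set_system T) {FF : Filter F} (f : T -> E) (l : E) :
  f @ F --> l <-> forall U, nbhs 0 U -> \forall x \near F, U (f x - l).
Proof.
split => [fl U U0|h U Ul].
  have h := fl _ (nbhsT l U0); apply: (@filterS T F FF _ _ _ h) => x [u Uu lu].
  by rewrite -lu addrC addKr.
have := nbhsB (- l) Ul; rewrite addNr => /h lU; apply: filterS lU => x [u Uu].
by rewrite [- l + u]addrC /= => /addIr <-.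
Qed.

Lemma nbhs0_half U : nbhs 0 U ->
  exists2 V : set E, nbhs 0 V & forall x y, V x -> V y -> U (x + y).
Proof.
move=> U0; have := @add_continuous E (0, 0) U; rewrite /= addr0 => /(_ U0).
move=> [[V V'] /= [V0 V'0] VU]; exists (V `&` V'); first exact: filterI.
by move=> x y [Vx _] [_ Vy]; apply: (VU (x, y)).
Qed.

Lemma balanced_convex_absolutely_convex W : W !=set0 ->
  (forall (a : C) x, nc a <= 1 -> W x -> W (a *: x)) ->
  (forall (t : R) x y, 0 <= t -> t <= 1 -> W x -> W y ->
     W (t%:C *: x + (1 - t)%:C *: y)) ->
  absolutely_convex W.
Proof.
move=> W0 bW cW; split => // x y a b Wx Wy.
rewrite !normr_normc -rmorphD/= lecR => ab1.
have [a0|a0] := eqVneq a 0.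
  rewrite a0 scale0r add0r; apply: bW => //.
  by apply: le_trans ab1; rewrite lerDr normc_ge0.
have [b0|b0] := eqVneq b 0.
  rewrite b0 scale0r addr0; apply: bW => //.
  by apply: le_trans ab1; rewrite lerDl normc_ge0.
set s := nc a in ab1; set t := nc b in ab1.
have s0 : 0 < s by rewrite normc_gt0.
have t0 : 0 < t by rewrite normc_gt0.
have st0 : 0 < s + t by rewrite addr_gt0.
have := cW (s / (s + t)) (((s + t) / s)%:C * a *: x) (((s + t) / t)%:C * b *: y).
have -> : 0 <= s / (s + t) by apply/ltW/divr_gt0.
have -> : s / (s + t) <= 1 by rewrite ler_pdivrMr// mul1r lerDl ltW.
move=> /(_ isT isT).
have -> : 1 - s / (s + t) = t / (s + t) by field; lra.
rewrite !scalerA !mulrA -!rmorphM/=.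
have -> : s / (s + t) * ((s + t) / s) = 1 by field; lra.
have -> : t / (s + t) * ((s + t) / t) = 1 by field; lra.
rewrite !mul1r; apply; apply: bW => //; rewrite Normc.normcM normcR.
  by rewrite gtr0_norm ?divr_gt0// divfK ?gt_eqF.
by rewrite gtr0_norm ?divr_gt0// divfK ?gt_eqF.
Qed.

(** The elements whose multiples by the closed unit disc all stay in a convex
neighbourhood b form a neighbourhood, because scaling is continuous at
(0, 0). *)
Lemma nbhs0_absolutely_convex U : nbhs 0 U ->
  exists W, [/\ absolutely_convex W, nbhs 0 W & W `<=` U].
Proof.
move=> U0; have [Bs Bcvx [Bopen Bbasis]] := @locally_convex C E.
have [b [Bb b0] bU] := Bbasis 0 U U0.
have nb : nbhs 0 b by apply: open_nbhs_nbhs; split => //; exact: Bopen.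
have bcvx (t : R) x y : 0 <= t -> t <= 1 -> b x -> b y ->
    b (t%:C *: x + (1 - t)%:C *: y).
  move=> t0 t1 bx by_.
  have t01 : Itv.spec (@Itv.num_sem C) (Itv.Real `[0%Z, 1%Z]) (t%:C : C).
    by rewrite /= /Itv.num_sem/= ger0_real/= ?in_itv/= ?lecR ?t0.
  have /set_mem := Bcvx b (mem_set Bb) x y (Itv.Def t01) (mem_set bx) (mem_set by_).
  by have -> : (1 - t)%:C = 1 - t%:C :> C by exact: rmorphB.
pose W := [set x | forall a : C, nc a <= 1 -> b (a *: x)].
have bW (a : C) x : nc a <= 1 -> W x -> W (a *: x).
  move=> a1 Wx c c1; rewrite scalerA; apply: Wx; rewrite Normc.normcM.
  by rewrite mulr_ile1 ?normc_ge0.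
exists W; split.
- apply: balanced_convex_absolutely_convex => //.
    by exists 0 => a _; rewrite scaler0.
  move=> t x y t0 t1 Wx Wy a a1.
  rewrite scalerDr !scalerA ![a * _]mulrC -!scalerA.
  by apply: bcvx => //; [exact: Wx|exact: Wy].
- have := @scale_continuous C E (0, 0) b; rewrite /= scaler0 => /(_ nb).
  move=> [[N V] /= [/(@nbhs_normcP R)[e e0 eN] V0] NV].
  have e20 : (e / 2)%:C != 0 :> C by rewrite (inj_eq (@complexI _)) gt_eqF ?divr_gt0.
  apply: filterS (nbhs0Z e20 V0) => _ [v Vv <-] a a1.
  rewrite scalerA; apply: (NV (_, _)); split => //=; apply: eN.
  rewrite subr0 Normc.normcM normcR gtr0_norm ?divr_gt0//.
  apply: le_lt_trans (ler_piMl _ a1) _; first by rewrite divr_ge0 ?ltW.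
  by rewrite ltr_pdivrMr// ltr_pMr// ltr1n.
- by move=> x Wx; apply: bU; rewrite -[x]scale1r; apply: Wx; rewrite Normc.normc1.
Qed.

Lemma nbhs0_absorbing U x : nbhs 0 U ->
  exists2 t : R, 0 < t & exists2 y, U y & x = t%:C *: y.
Proof.
move=> U0; have := @scale_continuous C E (0, x) U; rewrite /= scale0r => /(_ U0).
move=> [[N V] /= [/(@nbhs_normcP R)[e e0 eN] Vx] NV].
exists (2 / e); first by rewrite divr_gt0.
exists ((e / 2)%:C *: x).
  apply: (NV (_, _)); split => /=; last exact: nbhs_singleton.
  apply: eN; rewrite subr0 normcR gtr0_norm ?divr_gt0//.
  by rewrite ltr_pdivrMr// ltr_pMr// ltr1n.
rewrite scalerA -rmorphM/= (_ : 2 / e * (e / 2) = 1) ?scale1r//.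
by field; lra.
Qed.

Lemma gauge_le D (t : R) y : 0 < t -> D y -> gauge D (t%:C *: y) <= t.
Proof.
move=> t0 Dy; apply: ge_inf; last by split => //; exists y.
by exists 0 => z [/ltW].
Qed.

Lemma gauge_lt D x (e : R) :
  (exists2 t : R, 0 < t & exists2 y, D y & x = t%:C *: y) -> gauge D x < e ->
  exists t : R, [/\ 0 < t, t < e & exists2 y, D y & x = t%:C *: y].
Proof.
move=> [t t0 [y Dy xty]] /inf_lt[|s [s0 Ds] se]; last by exists s.
by exists t; split => //; exists y.
Qed.

Lemma gauge_sublinear W : absolutely_convex W -> nbhs 0 W -> sublinear (gauge W).
Proof.
move=> [_ cW] W0.
have nonempty x : [set t : R | 0 < t /\ exists2 y, W y & x = t%:C *: y] !=set0.
  by have [t t0 [y Wy ->]] := nbhs0_absorbing x W0; exists t; split => //; exists y.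
split => [x y|r x r0].
- rewrite -lerBlDl; apply: lb_le_inf => // t [t0 [y' Wy ->]].
  rewrite lerBlDl -lerBlDr; apply: lb_le_inf => // s [s0 [x' Wx ->]].
  rewrite lerBlDr; have st0 : 0 < s + t by rewrite addr_gt0.
  rewrite (_ : _ + _ = (s + t)%:C *: ((s / (s + t))%:C *: x' + (t / (s + t))%:C *: y')).
    apply: gauge_le => //; apply: cW => //; rewrite !normr_normc !normcR.
    rewrite -rmorphD/= lecR !gtr0_norm ?divr_gt0// -mulrDl divff// gt_eqF//.
  by rewrite scalerDr !scalerA -!rmorphM/= ![(s + t) * _]mulrC !divfK ?gt_eqF.
- rewrite mulrC -ler_pdivrMr//; apply: lb_le_inf => // t [t0 [y Wy ->]].
  rewrite ler_pdivrMr// scalerA -rmorphM/= mulrC; apply: gauge_le => //.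
  exact: mulr_gt0.
Qed.

Lemma gaugeZ_le W (a : C) x : absolutely_convex W -> nbhs 0 W ->
  gauge W (a *: x) <= nc a * gauge W x.
Proof.
move=> cW W0; have sW := gauge_sublinear cW W0.
have rot (b : C) y : nc b = 1 -> gauge W (b *: y) <= gauge W y.
  move=> b1; apply: lb_le_inf.
    by have [t t0 [v Wv ->]] := nbhs0_absorbing y W0; exists t; split => //; exists v.
  move=> t [t0 [v Wv ->]]; rewrite scalerA mulrC -scalerA; apply: gauge_le => //.
  rewrite -[_ *: v]addr0 -(scale0r v); apply: cW.2 => //.
  by rewrite normr0 addr0 normr_normc b1.
have [->|a0] := eqVneq a 0.
  by rewrite Normc.normc0 mul0r scale0r -{1}(scale0r x) sublinearZ// mul0r.
rewrite -{1}(divfK (_ : (nc a)%:C != 0) a) 1?mulrC ?scalerA; last first.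
  by rewrite (inj_eq (@complexI _)) normc_eq0.
rewrite -scalerA sublinearZ ?normc_ge0// ler_wpM2l ?normc_ge0// rot//.
rewrite Normc.normcM Normc.normcV normcR ger0_norm ?normc_ge0// divff// normc_eq0//.
Qed.

Lemma gauge_lt1 W x : absolutely_convex W -> nbhs 0 W -> gauge W x < 1 -> W x.
Proof.
move=> cW W0 x1; have [t [t0 t1 [y Wy ->]]] := gauge_lt (nbhs0_absorbing x W0) x1.
rewrite -[_ *: y]addr0 -(scale0r y); apply: cW.2 => //.
by rewrite normr0 addr0 normr_normc normcR lecR gtr0_norm// ltW.
Qed.

Lemma seminorm_continuous W (phi : {scalar E}) : nbhs 0 W ->
  (forall x, nc (phi x) <= gauge W x) -> continuous phi.
Proof.
move=> W0 phiW x; apply/cvg_normcP => e e0.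
have e20 : (e / 2)%:C != 0 :> C by rewrite (inj_eq (@complexI _)) gt_eqF ?divr_gt0.
have := nbhsT x (nbhs0Z e20 W0); apply: filterS => _ [_ [w Ww <-] <-].
rewrite linearD addrC addKr; apply: le_lt_trans (phiW _) _.
apply: le_lt_trans (gauge_le _ Ww) _; first exact: divr_gt0.
by rewrite ltr_pdivrMr// ltr_pMr// ltr1n.
Qed.

(** The real functional u of the Hahn-Banach theorem is the real part of the
complex functional u x - i u (i x).  Rotating x makes the value real, and the
gauge does not see rotations. *)
Lemma exists_supporting_functional W x0 : absolutely_convex W -> nbhs 0 W ->
  exists phi : {scalar E}, [/\ continuous phi,
    forall x, nc (phi x) <= gauge W x & gauge W x0 <= nc (phi x0)].
Proof.
move=> cW W0.
have [u [uD uZ uW ux0]] := hahn_banach x0 (gauge_sublinear cW W0).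
have uN x : u (- x) = - u x.
  by rewrite -scaleN1r (_ : -1 = (-1)%:C) ?uZ ?mulN1r// rmorphN.
pose f x : C := u x -i* u ('i%C *: x).
have fD x y : f (x + y) = f x + f y by rewrite /f scalerDr !uD opprD.
have fi x : f ('i%C *: x) = 'i%C * f x.
  rewrite /f scalerA -expr2 sqr_i scaleN1r uN; apply/eqP; rewrite eq_complex/=.
  by rewrite !mul0r !mul1r !add0r !opprK !eqxx.
have fR (r : R) x : f (r%:C *: x) = r%:C * f x.
  rewrite /f scalerA mulrC -scalerA !uZ; apply/eqP; rewrite eq_complex/=.
  by rewrite !mul0r subr0 addr0 mulrN !eqxx.
have fs : scalar f.
  move=> a x y; rewrite fD; congr (_ + _).
  rewrite [a]complexE scalerDl fD -scalerA fi !fR.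
  by rewrite mulrA -mulrDl.
pose phi : {scalar E} := HB.pack f (GRing.isLinear.Build _ _ _ _ f fs).
have phiW x : nc (phi x) <= gauge W x.
  have [p0|p0] := eqVneq (phi x) 0.
    rewrite p0 Normc.normc0; apply: lb_le_inf => [|t [/ltW//]].
    by have [t t0 [y Wy ->]] := nbhs0_absorbing x W0; exists t; split => //; exists y.
  (* a rotates phi x onto the positive real axis, where phi agrees with u *)
  pose a : C := (nc (phi x))%:C / phi x.
  have a1 : nc a = 1.
    by rewrite Normc.normcM Normc.normcV normcR ger0_norm ?normc_ge0// divff// normc_eq0.
  have -> : nc (phi x) = u (a *: x).
    have : phi (a *: x) = (nc (phi x))%:C.
      by rewrite linearZ/= /a mulrVK// unitfE.
    by move/(congr1 (@complex.Re R)).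
  apply: le_trans (uW _) _; apply: le_trans (gaugeZ_le _ _ cW W0) _.
  by rewrite a1 mul1r.
exists phi; split => //; first exact: seminorm_continuous W0 phiW.
rewrite -ux0; apply: le_trans (normc_Re _); exact: ler_norm.
Qed.

End LocallyConvexSpaces.

(** * Bipolars and Mackey convergence *)

Section Bipolar.
Context {R : realType} {E : tvsType R[i]}.
Local Notation C := R[i].
Local Notation nc := (@Normc.normc R).
Implicit Types (B : set E) (x y : E) (phi : {scalar E}).

(** Quantifying over all bounds c, and not only c = 1, gives the same set as
the polar of the polar of B, and spares the rescaling of phi. *)
Definition bipolar B : set E :=
  [set x | forall phi (c : R), continuous phi -> 0 <= c ->
     (forall b, B b -> nc (phi b) <= c) -> nc (phi x) <= c].

Lemma bipolarZ B (t : R) x : 0 < t ->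
  (forall phi (c : R), continuous phi -> 0 <= c ->
     (forall b, B b -> nc (phi b) <= c) -> nc (phi x) <= t * c) ->
  exists2 y, bipolar B y & x = t%:C *: y.
Proof.
move=> t0 xt; have tC0 : t%:C != 0 :> C by rewrite (inj_eq (@complexI _)) gt_eqF.
exists (t%:C^-1 *: x); last by rewrite scalerA divff// scale1r.
move=> phi c cphi c0 Bc; rewrite linearZ Normc.normcM Normc.normcV normcR.
by rewrite gtr0_norm// ler_pdivrMl//; exact: xt.
Qed.

Lemma bipolar_scaled_le B (t : R) y phi (c : R) : 0 < t -> bipolar B y ->
  continuous phi -> 0 <= c -> (forall b, B b -> nc (phi b) <= c) ->
  nc (phi (t%:C *: y)) <= t * c.
Proof.
move=> t0 By cphi c0 Bc; rewrite linearZ Normc.normcM normcR gtr0_norm//.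
by rewrite ler_pM2l//; exact: By.
Qed.

Lemma bipolar_absolutely_convex B : absolutely_convex (bipolar B).
Proof.
split=> [|x y a b Bx By]; first by exists 0 => phi c _ c0 _; rewrite linear0 Normc.normc0.
rewrite !normr_normc -rmorphD/= lecR => ab1 phi c cphi c0 Bc.
rewrite linearD !linearZ; apply: le_trans (le_normcD _ _) _.
rewrite !Normc.normcM -[leRHS]mul1r; apply: le_trans (ler_wpM2r c0 ab1).
by rewrite mulrDl lerD// ler_wpM2l ?normc_ge0//; [exact: Bx|exact: By].
Qed.

Lemma bipolar_closed B : closed (bipolar B).
Proof.
move=> x clx phi c cphi c0 Bc; rewrite leNgt; apply/negP => cx.
have e0 : 0 < nc (phi x) - c by rewrite subr_gt0.
have /cvg_normcP/(_ _ e0) xn := cphi x.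
have [y [By /= yx]] := clx _ xn.
have := le_normcD (phi x - phi y) (phi y); rewrite subrK normcB.
have := By phi c cphi c0 Bc; lra.
Qed.

(** A neighbourhood W absorbs B, and the gauge of W at any x is attained by a
functional below this gauge; such a functional is controlled on the bipolar
by its values on B. *)
Lemma bipolar_bounded B : tvs_bounded B -> tvs_bounded (bipolar B).
Proof.
move=> bB U U0; have [W [cW W0 WU]] := nbhs0_absolutely_convex U0.
have [r r0 BrW] := bB W W0.
(* a gauge at most r gives membership only in larger multiples of W *)
exists (2 * r); first by rewrite mulr_gt0.
move=> x Bx; have [phi [cphi phiW Wx]] := exists_supporting_functional x cW W0.
have gx : gauge W x <= r.
  apply: le_trans Wx _; apply: Bx => //; first exact: ltW.
  move=> b /BrW [w Ww <-]; apply: le_trans (phiW _) _; exact: gauge_le.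
have gx2 : gauge W x < 2 * r by lra.
have [t [t0 t2 [y Wy ->]]] := gauge_lt (nbhs0_absorbing x W0) gx2.
exists ((t / (2 * r))%:C *: y).
  apply: WU; rewrite -[_ *: y]addr0 -(scale0r y); apply: cW.2 => //.
  rewrite normr0 addr0 normr_normc normcR lecR gtr0_norm; last first.
    by rewrite divr_gt0 ?mulr_gt0.
  by rewrite ler_pdivrMr ?mulr_gt0// mul1r ltW.
by rewrite scalerA -rmorphM/= mulrC divfK// gt_eqF// mulr_gt0.
Qed.

(** The two bounds say that Q h lies in K D and that Q h - Q k lies in
K (|h| + |k|) D for the bipolar D of B.  As D is a closed disk, the sequence
of the Q (eta n), with eta n tending to 0, is Cauchy for the gauge of D and
converges.  Its limit is also the limit of Q h, since the distance of
Q h and Q (eta n) is controlled. *)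
Lemma mackey_limit B (Q : C -> E) (delta K : R) : locally_complete E ->
  tvs_bounded B -> 0 < delta -> 0 < K ->
  (forall (h : C) phi (c : R), h != 0 -> nc h < delta -> continuous phi -> 0 <= c ->
     (forall b, B b -> nc (phi b) <= c) -> nc (phi (Q h)) <= K * c) ->
  (forall (h k : C) phi (c : R), h != 0 -> nc h < delta -> k != 0 -> nc k < delta ->
     continuous phi -> 0 <= c ->
     (forall b, B b -> nc (phi b) <= c) ->
     nc (phi (Q h - Q k)) <= K * (nc h + nc k) * c) ->
  exists l : E, Q h @[h --> (0 : C)^'] --> l.
Proof.
move=> lcE bB d0 K0 Qle Qcauchy; pose D := bipolar B.
have bD := bipolar_bounded bB.
have DB : disk D by split => //; exact: bipolar_absolutely_convex.
pose eta n : R := delta / 2 / n.+1%:R.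
have eta0 n : 0 < eta n by rewrite !divr_gt0.
have etad n : eta n < delta.
  rewrite /eta -mulrA -invfM ltr_pdivrMr ?mulr_gt0// ltr_pMr//.
  by have : 1 <= n.+1%:R :> R; [rewrite ler1n|lra].
have nc_eta n : nc (eta n)%:C = eta n by rewrite normcR gtr0_norm.
have eta_neq0 n : (eta n)%:C != 0 :> C by rewrite (inj_eq (@complexI _)) gt_eqF.
have eta_cvg e : 0 < e -> \forall n \near \oo, eta n < e.
  move=> e0; near=> n.
  have en : delta / 2 / e < n%:R by near: n; exact: nbhs_infty_gtr.
  rewrite ltr_pdivrMr// in en; rewrite /eta ltr_pdivrMr//.
  by apply: lt_trans en _; rewrite mulrC ltr_pM2l// ltr_nat.
pose u n := Q (eta n)%:C.
have u_span n : disk_span D (u n).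
  pose m := (Num.trunc K).+1.
  have Km : K <= m%:R by rewrite ltW// truncnS_gt.
  have [|y Dy ->] := @bipolarZ B m%:R (u n) (ltr0Sn _ _).
    move=> phi c cphi c0 Bc; apply: le_trans (ler_wpM2r c0 Km).
    by apply: Qle; rewrite ?nc_eta.
  by exists m => //=; exists y => //; rewrite rmorph_nat.
have u_diff m n : exists2 y, D y & u m - u n = (K * (eta m + eta n))%:C *: y.
  apply: bipolarZ; first by rewrite mulr_gt0// addr_gt0.
  move=> phi c cphi c0 Bc; have := @Qcauchy (eta m)%:C (eta n)%:C phi c.
  by rewrite !nc_eta; exact.
have u_cauchy e : 0 < e -> \forall m & n \near \oo, gauge D (u m - u n) < e.
  move=> e0; have eK : 0 < e / (2 * K) by rewrite divr_gt0// mulr_gt0.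
  near=> m n; have [y Dy ->] := u_diff m n.
  apply: le_lt_trans (gauge_le _ Dy) _; first by rewrite mulr_gt0// addr_gt0.
  rewrite mulrC -ltr_pdivlMr//.
  have -> : e / K = e / (2 * K) + e / (2 * K) by field; lra.
  by rewrite ltrD//; [near: m|near: n]; exact: eta_cvg.
have [l [n0 n00 [y0 Dy0 ly0]] ul] := lcE D DB (@bipolar_closed B) u u_span u_cauchy.
(* [gauge_lt] is informative only for elements absorbed by D *)
have ul_span n : exists2 t : R, 0 < t & exists2 y, D y & u n - l = t%:C *: y.
  have [m m0 [y Dy uy]] := u_span n; exists (m + n0)%:R.
    by rewrite ltr0n addn_gt0 m0.
  apply: bipolarZ; first by rewrite ltr0n addn_gt0 m0.
  move=> phi c cphi c0 Bc; rewrite -uy -ly0 linearB natrD mulrDl.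
  apply: le_trans (le_normcB _ _) _; rewrite -!(rmorph_nat (real_complex R)).
  by apply: lerD; apply: (bipolar_scaled_le _ _ cphi c0 Bc) => //; rewrite ltr0n.
exists l; apply/cvg_tvsP => U U0.
have [W [cW W0 WU]] := nbhs0_absolutely_convex U0.
have [r r0 DrW] := bD W W0.
apply/dnbhs_normcP; exists (Num.min delta (2 * K * r)^-1).
  by rewrite lt_min d0 invr_gt0 !mulr_gt0.
move=> h h0; rewrite lt_min => /andP[hd hr].
have nh0 : 0 < nc h by rewrite normc_gt0.
have Kh : 0 < K * nc h by rewrite mulr_gt0.
(* with eta n < |h| / 2, Q h - Q (eta n) costs 3/2 K |h| and Q (eta n) - l the rest *)
have [y Dy ->] : exists2 y, D y & Q h - l = (2 * K * nc h)%:C *: y.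
  apply: bipolarZ; first by rewrite !mulr_gt0.
  move=> phi c cphi c0 Bc.
  have nh2 : 0 < nc h / 2 by rewrite divr_gt0.
  have Kh2 : 0 < K * nc h / 2 by rewrite divr_gt0.
  near \oo => n.
  have en : eta n < nc h / 2 by near: n; exact: eta_cvg.
  have gn : gauge D (u n - l) < K * nc h / 2.
    near: n; move: ul => /cvgrPdist_lt/(_ _ Kh2); apply: filterS => n.
    by rewrite sub0r normrN; apply: le_lt_trans; exact: ler_norm.
  have [t [t0 tK [y Dy uy]]] := gauge_lt (ul_span n) gn.
  have -> : Q h - l = (Q h - u n) + (u n - l) by rewrite addrA subrK.
  rewrite linearD; apply: le_trans (le_normcD _ _) _.
  have h1 := @Qcauchy h (eta n)%:C phi c h0 hd (eta_neq0 n).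
  rewrite nc_eta in h1; have {}h1 := h1 (etad n) cphi c0 Bc.
  have h2 := bipolar_scaled_le t0 Dy cphi c0 Bc; rewrite -uy in h2.
  have h3 : t * c <= K * nc h / 2 * c by rewrite ler_wpM2r// ltW.
  have h4 : K * (nc h + eta n) * c <= K * (nc h + nc h / 2) * c.
    by rewrite ler_wpM2r// ler_wpM2l ?ltW// ltrD2l.
  by lra.
have [w Ww <-] := DrW _ Dy; rewrite scalerA -rmorphM/=.
apply: WU; rewrite -[_ *: w]addr0 -(scale0r w); apply: cW.2 => //.
rewrite normr0 addr0 normr_normc normcR lecR gtr0_norm ?mulr_gt0//.
rewrite mulrAC mulrC -ler_pdivlMr ?mulr_gt0//.
by rewrite mul1r ltW.
Unshelve. all: by end_near. Qed.

End Bipolar.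

(** * Integrals of bounded measurable complex functions *)

Section ComplexIntegral.
Context {disp : measure_display} {T : measurableType disp} {R : realType}.
Variables (mu : {measure set T -> \bar R}) (D : set T).
Hypotheses (mD : measurable D) (muD : (mu D < +oo)%E).
Local Notation C := R[i].
Local Notation nc := (@Normc.normc R).
Implicit Types f g : T -> C.

(** On a set of finite measure these functions are integrable, and they are
stable under products, which integrable functions are not. *)
Definition bounded_measurable f : Prop :=
  [/\ measurable_fun D (@complex.Re R \o f), measurable_fun D (@complex.Im R \o f) &
      exists M, forall x, D x -> nc (f x) <= M].

Lemma bounded_measurable_cintegrable f : bounded_measurable f -> cintegrable mu D f.
Proof.
move=> [mRe mIm [M fM]]; split; apply: measurable_bounded_integrable => //.
- exists M; split; rewrite ?num_real// => N MN x Dx.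
  by apply: le_trans (normc_Re _) _; apply: le_trans (fM x Dx) (ltW MN).
- exists M; split; rewrite ?num_real// => N MN x Dx.
  by apply: le_trans (normc_Im _) _; apply: le_trans (fM x Dx) (ltW MN).
Qed.

Lemma bounded_measurable_cst a : bounded_measurable (fun=> a).
Proof. by split; [exact: measurable_cst|exact: measurable_cst|exists (nc a)]. Qed.

Lemma bounded_measurableD f g :
  bounded_measurable f -> bounded_measurable g -> bounded_measurable (fun x => f x + g x).
Proof.
move=> [fR fI [M fM]] [gR gI [N gN]]; split.
- rewrite (_ : _ \o _ = (@complex.Re R \o f) \+ (@complex.Re R \o g)).
    exact: measurable_funD.
  by apply/funext => x /=; case: (f x) (g x) => ? ? [].
- rewrite (_ : _ \o _ = (@complex.Im R \o f) \+ (@complex.Im R \o g)).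
    exact: measurable_funD.
  by apply/funext => x /=; case: (f x) (g x) => ? ? [].
- exists (M + N) => x Dx; apply: le_trans (le_normcD _ _) _.
  by rewrite lerD// ?fM ?gN.
Qed.

Lemma bounded_measurableM f g :
  bounded_measurable f -> bounded_measurable g -> bounded_measurable (fun x => f x * g x).
Proof.
move=> [fR fI [M fM]] [gR gI [N gN]]; split.
- rewrite (_ : _ \o _ = ((@complex.Re R \o f) \* (@complex.Re R \o g)) \-
                        ((@complex.Im R \o f) \* (@complex.Im R \o g))).
    by apply: measurable_funB; exact: measurable_funM.
  by apply/funext => x /=; case: (f x) (g x) => ? ? [].
- rewrite (_ : _ \o _ = ((@complex.Re R \o f) \* (@complex.Im R \o g)) \+
                        ((@complex.Im R \o f) \* (@complex.Re R \o g))).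
    by apply: measurable_funD; exact: measurable_funM.
  by apply/funext => x /=; case: (f x) (g x) => ? ? [].
- exists (M * N) => x Dx; rewrite Normc.normcM.
  by apply: ler_pM; rewrite ?normc_ge0// ?fM ?gN.
Qed.

Lemma bounded_measurableB f g :
  bounded_measurable f -> bounded_measurable g -> bounded_measurable (fun x => f x - g x).
Proof.
move=> bf bg; have := bounded_measurableM (bounded_measurable_cst (-1)) bg.
move=> /(bounded_measurableD bf); congr bounded_measurable.
by apply/funext => x; rewrite mulN1r.
Qed.

Lemma eq_cintegral f g : (forall x, D x -> f x = g x) ->
  cintegral mu D f = cintegral mu D g.
Proof.
by move=> fg; congr (_ +i* _); apply: eq_Rintegral => x /set_mem Dx; rewrite fg.
Qed.

Lemma cintegralD f g : bounded_measurable f -> bounded_measurable g ->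
  cintegral mu D (fun x => f x + g x) = cintegral mu D f + cintegral mu D g.
Proof.
move=> /bounded_measurable_cintegrable[fR fI] /bounded_measurable_cintegrable[gR gI].
apply/eqP; rewrite eq_complex/= -!RintegralD//.
by apply/andP; split; apply/eqP; apply: eq_Rintegral => x _; case: (f x) (g x) => ? ? [].
Qed.

Lemma cintegralZ a f : bounded_measurable f ->
  cintegral mu D (fun x => a * f x) = a * cintegral mu D f.
Proof.
move=> /bounded_measurable_cintegrable[fR fI].
have ZI (r : R) (h : T -> R) : mu.-integrable D (EFin \o h) ->
    mu.-integrable D (EFin \o (fun x => r * h x)).
  move=> hI; rewrite (_ : EFin \o _ = (fun x => r%:E * (EFin \o h) x)%E)//.
  exact: integrableZl.
case: a => a b; apply/eqP; rewrite eq_complex/= -!RintegralZl//.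
rewrite -RintegralB//; [|exact: ZI|exact: ZI].
rewrite -RintegralD//; [|exact: ZI|exact: ZI].
by apply/andP; split; apply/eqP; apply: eq_Rintegral => x _; case: (f x).
Qed.

Lemma cintegralB f g : bounded_measurable f -> bounded_measurable g ->
  cintegral mu D (fun x => f x - g x) = cintegral mu D f - cintegral mu D g.
Proof.
move=> bf bg; rewrite -mulN1r -cintegralZ// -cintegralD//.
  by apply: eq_cintegral => x _; rewrite mulN1r.
exact: bounded_measurableM (bounded_measurable_cst _) bg.
Qed.

(** The factor 2 is the price of estimating the real and imaginary parts
separately. *)
Lemma normc_cintegral f M : bounded_measurable f ->
  (forall x, D x -> nc (f x) <= M) ->
  nc (cintegral mu D f) <= 2 * M * fine (mu D).
Proof.
move=> bf fM; have [fR fI] := bounded_measurable_cintegrable bf.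
have le_int (h : T -> R) : mu.-integrable D (EFin \o h) ->
    (forall x, D x -> `|h x| <= M) -> `|\int[mu]_(x in D) h x| <= M * fine (mu D).
  move=> hI hM; apply: le_trans (le_normr_Rintegral mD hI) _.
  rewrite -Rintegral_cst//; apply: le_Rintegral => //.
  - exact: (integrable_norm hI).
  - apply: measurable_bounded_integrable => //; exists `|M|.
    by split; rewrite ?num_real// => N MN x _; exact: ltW.
apply: le_trans (normc_le_ReIm _) _ => /=.
rewrite -mulrA mulr_natl mulr2n; apply: lerD; apply: le_int => // x Dx.
  exact: le_trans (normc_Re _) (fM x Dx).
exact: le_trans (normc_Im _) (fM x Dx).
Qed.

End ComplexIntegral.

(** * Derivatives of complex curves *)

Section ComplexCurves.
Context {R : realType}.
Local Notation C := R[i].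
Local Notation nc := (@Normc.normc R).

Lemma ReB (a b : C) : complex.Re (a - b) = complex.Re a - complex.Re b.
Proof. by case: a b => ? ? []. Qed.

Lemma ImB (a b : C) : complex.Im (a - b) = complex.Im a - complex.Im b.
Proof. by case: a b => ? ? []. Qed.

Lemma cvg_ReIm {T : Type} (F : set_system T) {FF : Filter F} (f : T -> C) (l : C) :
  f @ F --> l <->
  (complex.Re (f x) @[x --> F] --> complex.Re l) /\
  (complex.Im (f x) @[x --> F] --> complex.Im l).
Proof.
split => [/cvg_normcP fl|[fR fI]].
  split; apply/cvgrPdist_lt => e /fl; apply: filterS => x; rewrite normcB; apply: le_lt_trans.
    by rewrite -ReB normc_Re.
  by rewrite -ImB normc_Im.
apply/cvg_normcP => e e0; have e20 : 0 < e / 2 by rewrite divr_gt0.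
move: fR => /cvgrPdist_lt/(_ _ e20) fR; move: fI => /cvgrPdist_lt/(_ _ e20) fI.
near=> x; rewrite normcB; apply: le_lt_trans (normc_le_ReIm _) _.
rewrite [e]splitr ReB ImB ltrD//; first by near: x.
by near: x.
Unshelve. all: by end_near. Qed.

Definition is_cderive (g : C -> C) (z l : C) : Prop :=
  h^-1 * (g (z + h) - g z) @[h --> (0 : C)^'] --> l.

Definition is_curve_derive (c : R -> C) (s : R) (l : C) : Prop :=
  is_derive s 1 (@complex.Re R \o c) (complex.Re l) /\
  is_derive s 1 (@complex.Im R \o c) (complex.Im l).

Lemma is_deriveP (f : R -> R) (s l : R) :
  is_derive s 1 f l <-> h^-1 * (f (s + h) - f s) @[h --> (0 : R)^'] --> l.
Proof.
have E : (fun h : R => h^-1 *: (f (h *: 1 + s) - f s)) =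
         (fun h => h^-1 * (f (s + h) - f s)).
  by apply/funext => h; rewrite [h *: 1]mulr1 [h + s]addrC.
split => [[+ <-]|fl].
  by rewrite /derivable /derive E.
apply: DeriveDef; rewrite /derivable /derive E; first by apply/cvg_ex; exists l.
exact: cvg_lim.
Qed.

Lemma is_curve_deriveP (c : R -> C) (s : R) (l : C) :
  is_curve_derive c s l <->
  h^-1%:C * (c (s + h) - c s) @[h --> (0 : R)^'] --> l.
Proof.
rewrite /is_curve_derive !is_deriveP cvg_ReIm.
have E (h : R) : h^-1%:C * (c (s + h) - c s) =
   (h^-1 * (complex.Re (c (s + h)) - complex.Re (c s))) +i*
   (h^-1 * (complex.Im (c (s + h)) - complex.Im (c s))).
  by case: (c (s + h)) (c s) => ? ? []??; apply/eqP; rewrite eq_complex/= !mul0r subr0 addr0 !eqxx.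
rewrite (_ : (fun h => complex.Re _) =
    fun h => h^-1 * ((@complex.Re R \o c) (s + h) - (@complex.Re R \o c) s)); last first.
  by apply/funext => h; rewrite E.
rewrite (_ : (fun h => complex.Im _) =
    fun h => h^-1 * ((@complex.Im R \o c) (s + h) - (@complex.Im R \o c) s)) //.
by apply/funext => h; rewrite E.
Qed.

Lemma curve_derive_continuous (c : R -> C) (s : R) (l : C) :
  is_curve_derive c s l -> {for s, continuous c}.
Proof.
move=> [cR cI]; apply/cvg_ReIm; split; apply: differentiable_continuous; apply/derivable1_diffP;
  by apply: ex_derive.
Qed.

(** The difference quotient A of g at c s, completed by the value l at c s, is
continuous there, so the factorisation through A survives the zeros of
c (s + h) - c s. *)
Lemma is_curve_derive_comp (g : C -> C) (c : R -> C) (s : R) (l m : C) :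
  is_cderive g (c s) l -> is_curve_derive c s m ->
  is_curve_derive (g \o c) s (l * m).
Proof.
move=> gl cm; have cc := curve_derive_continuous cm.
move/is_curve_deriveP : cm => cm; apply/is_curve_deriveP.
pose A (w : C) : C := if w == c s then l else (w - c s)^-1 * (g w - g (c s)).
have Ac : A @ nbhs (c s) --> l.
  apply/cvg_normcP => e e0; move/cvg_normcP/(_ _ e0)/dnbhs_normcP : gl => [d d0 dl].
  apply/nbhs_normcP; exists d => // w wd; rewrite /A.
  case: eqP => [_|/eqP wc]; first by rewrite subrr Normc.normc0.
  by have := dl (w - c s); rewrite subr_eq0 [c s + _]addrC subrK; exact.
have AE h : h^-1%:C * (g (c (s + h)) - g (c s)) =
    A (c (s + h)) * (h^-1%:C * (c (s + h) - c s)).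
  rewrite /A; case: eqP => [->|/eqP wc]; first by rewrite !subrr !mulr0.
  by rewrite [RHS]mulrAC [X in _ = X * _]mulrCA mulVf ?mulr1// subr_eq0.
rewrite (_ : (fun h => _) = fun h => A (c (s + h)) * (h^-1%:C * (c (s + h) - c s))); last first.
  by apply/funext => h; exact: AE.
suff Acs : A (c (s + h)) @[h --> (0 : R)^'] --> l by exact: (cvgM Acs cm).
have sh : s + h @[h --> (0 : R)^'] --> s.
  rewrite -[X in _ --> X]addr0; apply: cvgD; first exact: cvg_cst.
  by apply: cvg_within_filter; exact: cvg_id.
apply: (cvg_comp (fun h => c (s + h)) A _ Ac).
exact: (cvg_comp (fun h => s + h) c sh cc).
Qed.

Lemma is_curve_derive_affine (a b : C) (c : R -> C) (s : R) (l : C) :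
  is_curve_derive c s l -> is_curve_derive (fun t => a * c t + b) s (a * l).
Proof.
move=> /is_curve_deriveP cl; apply/is_curve_deriveP.
rewrite (_ : (fun h => _) = fun h => a * (h^-1%:C * (c (s + h) - c s))).
  exact: (cvgM (cvg_cst a) cl).
by apply/funext => h; ring.
Qed.

Lemma is_curve_derive_real (s : R) : is_curve_derive (real_complex R) s 1.
Proof.
by split; [exact: is_derive_id|exact: is_derive_cst].
Qed.

Lemma is_cderive_inv (z : C) : z != 0 -> is_cderive (fun w => w^-1) z (- z^-2).
Proof.
move=> z0; rewrite /is_cderive; have nz : 0 < nc z by rewrite normc_gt0.
have -> : - z^-2 = - z^-1 * z^-1 by rewrite mulNr -expr2 exprVn.
have inv_cvg : (z + h)^-1 @[h --> (0 : C)^'] --> z^-1.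
  apply: cvgV => //; rewrite -[X in _ --> X]addr0; apply: cvgD; first exact: cvg_cst.
  by apply: cvg_within_filter; exact: cvg_id.
apply: cvg_trans (cvgM (cvg_cst (- z^-1)) inv_cvg).
apply: near_eq_cvg; apply/dnbhs_normcP; exists (nc z) => // h h0 hz.
have zh : z + h != 0.
  apply/eqP => /eqP; rewrite addr_eq0 => /eqP E.
  by move: hz; rewrite E normcN ltxx.
by rewrite /=; field; rewrite zh h0 z0.
Qed.

End ComplexCurves.

(** * Integrals over circles *)

Section CircleIntegral.
Context {R : realType}.
Local Notation C := R[i].
Local Notation nc := (@Normc.normc R).
Local Notation mu := (@lebesgue_measure R).
Implicit Types (a z : C) (r t s : R).

Definition circle_speed r t : C := r%:C * (- sin t +i* cos t).

Lemma circle_path_derive a r t :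
  is_curve_derive (circle_path a r) t (circle_speed r t).
Proof.
case: a => x y; split.
- rewrite (_ : _ \o _ = fun t => x + r * cos t).
    apply: is_derive_eq; rewrite /circle_speed /= mul0r subr0 add0r.
    by rewrite mul1r.
  by apply/funext => z; rewrite /circle_path /= mul0r subr0.
- rewrite (_ : _ \o _ = fun t => y + r * sin t).
    apply: is_derive_eq; rewrite /circle_speed /= mul0r addr0 add0r.
    by rewrite mul1r.
  by apply/funext => z; rewrite /circle_path /= mul0r addr0.
Qed.

Lemma cderive1_circle_path a r t : cderive1 (circle_path a r) t = circle_speed r t.
Proof.
have [dR dI] := circle_path_derive a r t.
rewrite /cderive1 !derive1E !derive_val.
by case: (circle_speed r t).
Qed.

Lemma normc_cos_sin t : nc (cos t +i* sin t) = 1.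
Proof. by rewrite /= cos2Dsin2 sqrtr1. Qed.

Lemma normc_circle_path a r t : 0 <= r -> nc (circle_path a r t - a) = r.
Proof.
move=> r0; rewrite /circle_path addrC addKr Normc.normcM normc_cos_sin mulr1.
by rewrite normcR ger0_norm.
Qed.

Lemma normc_circle_speed r t : 0 <= r -> nc (circle_speed r t) = r.
Proof.
move=> r0; rewrite /circle_speed Normc.normcM normcR ger0_norm//.
by rewrite /= sqrrN addrC cos2Dsin2 sqrtr1 mulr1.
Qed.

Lemma circle_speedE a r t : circle_speed r t = 'i%C * (circle_path a r t - a).
Proof.
rewrite /circle_path addrC addKr mulrCA; congr (_ * _).
by apply/eqP; rewrite eq_complex/= !mul0r !mul1r sub0r add0r !eqxx.
Qed.

Lemma circle_path_2pi a r : circle_path a r (2 * pi) = circle_path a r 0.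
Proof.
rewrite /circle_path (_ : 2 * pi = pi *+ 2) ?cos2pi ?sin2pi ?cos0 ?sin0//.
by rewrite mulr_natl.
Qed.

Lemma circle_path_continuous a r : continuous (circle_path a r).
Proof. by move=> t; exact: curve_derive_continuous (circle_path_derive a r t). Qed.

Lemma circle_speed_continuous r : continuous (circle_speed r).
Proof.
have -> : circle_speed r = fun x => 'i%C * circle_path 0 r x.
  by apply/funext => x; rewrite (circle_speedE 0) subr0.
by move=> t; exact: (cvgM (cvg_cst _) (@circle_path_continuous 0 r t)).
Qed.

Lemma continuous_bounded_measurable (f : R -> C) (D : set (measurableTypeR R)) (M : R) :
  measurable D ->
  continuous f -> (forall t, nc (f t) <= M) -> bounded_measurable D f.
Proof.
move=> mD fc fM; split; last by exists M.
- apply: (@measurable_funTS _ _ _ _ D); apply: continuous_measurable_fun => t.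
  by have /cvg_ReIm[] := fc t.
- apply: (@measurable_funTS _ _ _ _ D); apply: continuous_measurable_fun => t.
  by have /cvg_ReIm[] := fc t.
Qed.

Let D : set (measurableTypeR R) := `[0, 2 * pi]%classic.

Let pi20 : 0 < 2 * pi :> R. Proof. by rewrite mulr_gt0 ?pi_gt0. Qed.

Lemma measurable_period : measurable D.
Proof. exact: measurable_itv. Qed.

Lemma period_ltoo : (mu D < +oo)%E.
Proof. by rewrite lebesgue_measure_itv/= lte_fin pi20 EFinN sube0 ltry. Qed.

Lemma period_cintegrable (f : R -> C) : bounded_measurable D f -> cintegrable mu D f.
Proof.
exact: (@bounded_measurable_cintegrable _ (measurableTypeR R) R lebesgue_measure D
  measurable_period period_ltoo f).
Qed.

Lemma period_cintegralZ (a : C) (f : R -> C) : @bounded_measurable _ (measurableTypeR R) R D f ->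
  cintegral mu D (fun t => a * f t) = a * cintegral mu D f.
Proof.
exact: (@cintegralZ _ (measurableTypeR R) R lebesgue_measure D
  measurable_period period_ltoo a f).
Qed.

Lemma Rintegral_derive_loop (f f' : R -> R) : continuous f' ->
  (forall t, is_derive t 1 f (f' t)) -> f 0 = f (2 * pi) ->
  \int[mu]_(t in D) f' t = 0.
Proof.
move=> cf' df f0; rewrite /Rintegral (@continuous_FTC2 _ f' f)//.
- by rewrite f0 subee.
- exact: continuous_subspaceT.
- have cf t : {for t, continuous f}.
    by apply: differentiable_continuous; apply/derivable1_diffP; exact: ex_derive.
  split=> [t _||].
  + exact: ex_derive.
  + by apply: cvg_within_filter; exact: cf.
  + by apply: cvg_within_filter; exact: cf.
- by move=> t _; rewrite derive1E derive_val.
Qed.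

Lemma cintegral_derive_loop (c c' : R -> C) : continuous c' ->
  (forall t, is_curve_derive c t (c' t)) -> c 0 = c (2 * pi) ->
  cintegral mu D c' = 0.
Proof.
move=> cc' dc c0; apply/eqP; rewrite eq_complex/=; apply/andP; split; apply/eqP.
- apply: (@Rintegral_derive_loop (@complex.Re R \o c)) => [t|t|/=].
  + by have /cvg_ReIm[] := cc' t.
  + by have [] := dc t.
  + by rewrite c0.
- apply: (@Rintegral_derive_loop (@complex.Im R \o c)) => [t|t|/=].
  + by have /cvg_ReIm[] := cc' t.
  + by have [] := dc t.
  + by rewrite c0.
Qed.

(** The derivative in s of the integral is the integral of the derivative,
which vanishes.  The parameter ranges over an open interval around [0, 1],
so that differentiation under the integral covers the end points. *)
Lemma Rintegral_homotopy (F F' : R -> R -> R) (u v M : R) : u < 0 -> 1 < v ->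
  (forall s t, u < s < v -> is_derive s 1 (F^~ t) (F' s t)) ->
  (forall s, u < s < v -> mu.-integrable D (EFin \o F s)) ->
  (forall s t, u < s < v -> `|F' s t| <= M) ->
  (forall s, u < s < v -> \int[mu]_(t in D) F' s t = 0) ->
  \int[mu]_(t in D) F 0 t = \int[mu]_(t in D) F 1 t.
Proof.
move=> u0 v1 dF iF F'M F'0.
have M0 : 0 <= M by apply: le_trans (normr_ge0 _) (F'M 0 0 _); rewrite u0 (lt_trans _ v1).
pose I s := \int[mu]_(t in D) F s t.
have uvP s : `]u, v[%classic s -> u < s < v by rewrite /= in_itv.
have dI s : u < s < v -> is_derive s 1 I 0.
  move=> us; have Is : `]u, v[%classic s by rewrite /= in_itv.
  have iF' x : `]u, v[%classic x -> mu.-integrable D (EFin \o F x).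
    by move/uvP; exact: iF.
  have derF x y : `]u, v[%classic x -> D y -> derivable (F ^~ y) x 1.
    by move=> /uvP h _; exact: (@ex_derive _ _ _ _ _ _ _ (dF x y h)).
  have dFE x y : u < x < v -> partial1of2 F x y = F' x y.
    by move=> h; have := dF x y h => ?; rewrite partial1of2E derive_val.
  have ubF x y : `]u, v[%classic x -> D y -> `|partial1of2 F x y| <= M.
    by move=> /uvP h _; rewrite dFE// F'M.
  have iM : mu.-integrable D (EFin \o cst M).
    apply: (@measurable_bounded_integrable _ (measurableTypeR R) R lebesgue_measure
      (cst M) D measurable_period period_ltoo) => //.
    by exists `|M|; split; rewrite ?num_real// => N MN x _; exact: ltW.
  apply: DeriveDef.
    exact: (derivable_under_integral measurable_period Is iF' derF _ iM ubF).
  rewrite -derive1E (differentiation_under_integral measurable_period Is iF' derF _ iM ubF)//.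
  rewrite -[RHS](F'0 s us); apply: eq_Rintegral => t _.
  by rewrite dFE.
have Iuv s : s \in `[0, 1] -> u < s < v.
  by rewrite in_itv/= => /andP[s0 s1]; rewrite (lt_le_trans u0)//= (le_lt_trans s1).
have [||c _] := @MVT _ I (cst 0) 0 1 ltr01.
- by move=> s /subset_itv_oo_cc /Iuv; exact: dI.
- apply: derivable_within_continuous => s /Iuv us.
  exact: (@ex_derive _ _ _ _ _ _ _ (dI s us)).
by rewrite mul0r => /eqP; rewrite subr_eq0 => /eqP.
Qed.

(** The typical F' s is the derivative in t of a closed curve, whence the last
hypothesis, by [cintegral_derive_loop]. *)
Lemma cintegral_homotopy (F F' : R -> R -> C) (u v M : R) : u < 0 -> 1 < v ->
  (forall s t, u < s < v -> is_curve_derive (F^~ t) s (F' s t)) ->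
  (forall s, u < s < v -> bounded_measurable D (F s)) ->
  (forall s t, u < s < v -> nc (F' s t) <= M) ->
  (forall s, u < s < v -> cintegral mu D (F' s) = 0) ->
  cintegral mu D (F 0) = cintegral mu D (F 1).
Proof.
move=> u0 v1 dF bF F'M F'0; congr (_ +i* _).
- apply: (@Rintegral_homotopy (fun s => @complex.Re R \o F s)
    (fun s => @complex.Re R \o F' s) u v M) => //=.
  + by move=> s t /dF-/(_ t)[].
  + by move=> s /bF /period_cintegrable[].
  + by move=> s t us; apply: le_trans (normc_Re _) _; exact: F'M.
  + by move=> s /F'0 [].
- apply: (@Rintegral_homotopy (fun s => @complex.Im R \o F s)
    (fun s => @complex.Im R \o F' s) u v M) => //=.
  + by move=> s t /dF-/(_ t)[].
  + by move=> s /bF /period_cintegrable[].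
  + by move=> s t us; apply: le_trans (normc_Im _) _; exact: F'M.
  + by move=> s /F'0 [].
Qed.

End CircleIntegral.

(** * Cauchy's formula on a disc *)

Section CauchyDisc.
Context {R : realType}.
Local Notation C := R[i].
Local Notation nc := (@Normc.normc R).
Local Notation mu := (@lebesgue_measure R).
Local Notation D := (`[0, 2 * pi]%classic : set (measurableTypeR R)).
Implicit Types (a z : C).

Section Kernel.
Variables (a z : C) (r : R).
Hypotheses (za : nc (z - a) < r).

Let r0 : 0 < r. Proof. exact: le_lt_trans (normc_ge0 _) za. Qed.

Lemma circle_path_dist t : r - nc (z - a) <= nc (circle_path a r t - z).
Proof.
rewrite lerBlDr -{1}(normc_circle_path a t (ltW r0)).
by apply: le_trans (le_normcD _ _); rewrite addrA subrK.
Qed.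

Lemma circle_path_neq t : circle_path a r t - z != 0.
Proof.
by rewrite -normc_gt0; apply: lt_le_trans (circle_path_dist t); rewrite subr_gt0.
Qed.

Lemma normc_inv_circle_path t :
  nc (circle_path a r t - z)^-1 <= (r - nc (z - a))^-1.
Proof.
rewrite Normc.normcV lef_pV2 ?circle_path_dist//.
  by rewrite posrE normc_gt0 circle_path_neq.
by rewrite posrE subr_gt0.
Qed.

Lemma inv_circle_path_continuous : continuous (fun t => (circle_path a r t - z)^-1).
Proof.
move=> t; have ct : circle_path a r x - z @[x --> t] --> circle_path a r t - z.
  exact: (cvgB (@circle_path_continuous _ a r t) (cvg_cst z)).
exact: (cvgV (circle_path_neq t) ct).
Qed.

Definition cauchy_kernel t := circle_speed r t / (circle_path a r t - z).

Lemma normc_cauchy_kernel t : nc (cauchy_kernel t) <= r / (r - nc (z - a)).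
Proof.
rewrite Normc.normcM normc_circle_speed; last exact: ltW.
by rewrite ler_pM2l// normc_inv_circle_path.
Qed.

Lemma cauchy_kernel_continuous : continuous cauchy_kernel.
Proof.
move=> t; exact: (cvgM (@circle_speed_continuous _ r t) (@inv_circle_path_continuous t)).
Qed.

Lemma cauchy_kernel_bounded_measurable : bounded_measurable D cauchy_kernel.
Proof.
apply: (@continuous_bounded_measurable _ _ _ (r / (r - nc (z - a)))).
- exact: measurable_period.
- exact: cauchy_kernel_continuous.
- exact: normc_cauchy_kernel.
Qed.

(** The function -1/(x - z) is a primitive of 1/(x - z)^2. *)
Lemma cintegral_circle_speed_sqr :
  cintegral mu D (fun t => circle_speed r t / (circle_path a r t - z) ^+ 2) = 0.
Proof.
apply: (@cintegral_derive_loop _ (fun t => - (circle_path a r t - z)^-1)).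
- have -> : (fun t => circle_speed r t / (circle_path a r t - z) ^+ 2) =
      fun t => circle_speed r t * ((circle_path a r t - z)^-1 * (circle_path a r t - z)^-1).
    by apply/funext => t; rewrite expr2 invfM.
  move=> t; have ic := @inv_circle_path_continuous t.
  exact: (cvgM (@circle_speed_continuous _ r t) (cvgM ic ic)).
- move=> t.
  have d1 : is_curve_derive (fun t => circle_path a r t - z) t (circle_speed r t).
    have := is_curve_derive_affine 1 (- z) (circle_path_derive a r t).
    by rewrite mul1r; under [X in is_curve_derive X]eq_fun do rewrite mul1r.
  have := is_curve_derive_comp (is_cderive_inv (circle_path_neq t)) d1.
  move/(is_curve_derive_affine (-1) 0).
  rewrite mulN1r mulNr opprK mulrC.
  by under [X in is_curve_derive X]eq_fun do rewrite mulN1r addr0.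
- by rewrite circle_path_2pi.
Qed.

End Kernel.

Lemma cintegral_cst (c : C) : cintegral mu D (fun=> c) = (2 * pi)%:C * c.
Proof.
have muDE : fine (mu D) = 2 * pi.
  by rewrite lebesgue_measure_itv/= lte_fin mulr_gt0 ?pi_gt0//= oppr0 addr0.
rewrite /cintegral !Rintegral_cst; try exact: measurable_itv.
case: c => x y; apply/eqP; rewrite eq_complex/= !mul0r subr0 addr0 muDE.
by rewrite ![_ * (2 * pi)]mulrC !eqxx.
Qed.

(** The pole z moves along a segment to the centre a, where the kernel is
constantly i.  The derivative in the pole is an integral of 1/(x - z)^2 over
the circle, which is 0. *)
Lemma cintegral_cauchy_kernel a z r : nc (z - a) < r ->
  cintegral mu D (cauchy_kernel a z r) = 2 * pi%:C * (0 +i* 1).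
Proof.
move=> za; set q := nc (z - a) in za *.
have q0 : 0 <= q := normc_ge0 _.
have r0 : 0 < r by exact: le_lt_trans za.
(* margin beyond [0, 1] that keeps the pole within (r + q) / 2 of a *)
pose eta := (r - q) / (2 * r).
have eta0 : 0 < eta by rewrite divr_gt0 ?mulr_gt0// subr_gt0.
have etaq : eta * q <= (r - q) / 2.
  rewrite /eta invfM mulrA mulrAC -mulrA ler_piMr//; first by lra.
  by rewrite ler_pdivrMr// mul1r ltW.
pose zs (s : R) : C := a + s%:C * (z - a).
have zsq s : - eta < s < 1 + eta -> nc (zs s - a) <= (r + q) / 2.
  move=> /andP[s1 s2]; rewrite /zs addrC addKr Normc.normcM normcR -/q.
  have s3 : `|s| <= 1 + eta by rewrite ler_norml; lra.
  by apply: le_trans (ler_wpM2r q0 s3) _; rewrite mulrDl mul1r; lra.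
have zsr s : - eta < s < 1 + eta -> nc (zs s - a) < r.
  by move=> /zsq h; apply: le_lt_trans h _; lra.
have -> : cauchy_kernel a z r = cauchy_kernel a (zs 1) r.
  by rewrite /zs rmorph1 mul1r addrC subrK.
pose F s := cauchy_kernel a (zs s) r.
pose F' s t := (z - a) * (circle_speed r t / (circle_path a r t - zs s) ^+ 2).
have d0 : 0 < (r - q) / 2 by rewrite divr_gt0// subr_gt0.
have inv_le s t : - eta < s < 1 + eta ->
    nc (circle_path a r t - zs s)^-1 <= ((r - q) / 2)^-1.
  move=> us; apply: le_trans (normc_inv_circle_path (zsr s us) t) _.
  rewrite lef_pV2 ?posrE//; first by have := zsq s us; lra.
  by rewrite subr_gt0 zsr.
have <- : cintegral mu D (F 0) = cintegral mu D (F 1).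
  apply: (@cintegral_homotopy _ F F' (- eta) (1 + eta) (q * (r * ((r - q) / 2)^-1 ^+ 2))).
  - by rewrite oppr_lt0.
  - by rewrite ltrDl.
  - move=> s t us.
    have := is_curve_derive_affine (- (z - a)) (circle_path a r t - a) (is_curve_derive_real s).
    have -> : (fun x => - (z - a) * x%:C + (circle_path a r t - a)) =
              (fun x => circle_path a r t - zs x).
      by apply/funext => x; rewrite /zs; ring.
    move/(is_curve_derive_comp (is_cderive_inv (circle_path_neq (zsr s us) t))).
    move/(is_curve_derive_affine (circle_speed r t) 0).
    under [X in is_curve_derive X]eq_fun do rewrite addr0.
    rewrite (_ : circle_speed r t * _ = F' s t)// /F'.
    by rewrite mulr1 mulrNN; ring.
  - move=> s us; exact: (cauchy_kernel_bounded_measurable (zsr s us)).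
  - move=> s t us; rewrite /F' Normc.normcM -/q ler_wpM2l//.
    rewrite Normc.normcM (normc_circle_speed _ (ltW r0)) ler_pM2l// -exprVn normcX.
    by rewrite lerXn2r ?nnegrE ?normc_ge0 ?invr_ge0 ?inv_le// ltW.
  - move=> s us; rewrite period_cintegralZ; first by rewrite cintegral_circle_speed_sqr ?mulr0 ?zsr.
    apply: (@continuous_bounded_measurable _ _ _ (r * ((r - q) / 2)^-1 ^+ 2)).
    + exact: measurable_period.
    + have -> : (fun t => circle_speed r t / (circle_path a r t - zs s) ^+ 2) =
        fun t => circle_speed r t * ((circle_path a r t - zs s)^-1 * (circle_path a r t - zs s)^-1).
        by apply/funext => t; rewrite expr2 invfM.
      move=> t; have ic := @inv_circle_path_continuous a (zs s) r (zsr s us) t.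
      exact: (cvgM (@circle_speed_continuous _ r t) (cvgM ic ic)).
    + move=> t; rewrite Normc.normcM normc_circle_speed ?(ltW r0)//.
      rewrite ler_pM2l// -exprVn normcX.
      by rewrite lerXn2r ?nnegrE ?normc_ge0 ?invr_ge0 ?inv_le// ltW.
have -> : F 0 = fun=> 'i%C.
  apply/funext => t; rewrite /F /cauchy_kernel /zs mul0r addr0.
  by rewrite (circle_speedE a) mulfK// -normc_gt0 normc_circle_path ?ltW.
by rewrite cintegral_cst rmorphM/= rmorph_nat.
Qed.

(** The argument of g moves along p s t, from z at s = 0 to the circle at
s = 1, while the kernel is fixed.  At s = 0 the integral is g z times that of
the kernel.  The derivative in s of the integrand is
circle_speed * g' (p s t), which is 1/s times the derivative in t of
g (p s t), so its integral vanishes. *)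
Lemma cauchy_disc (g g' : C -> C) a z r r' M : nc (z - a) < r -> r < r' ->
  (forall w, nc (w - a) < r' -> is_cderive g w (g' w)) ->
  (forall w, nc (w - a) < r' -> {for w, continuous g'}) ->
  (forall w, nc (w - a) < r' -> nc (g w) <= M) ->
  (forall w, nc (w - a) < r' -> nc (g' w) <= M) ->
  cintegral mu D (fun t => cauchy_kernel a z r t * g (circle_path a r t)) =
    2 * pi%:C * (0 +i* 1) * g z.
Proof.
move=> za rr' dg cg' gM g'M; set q := nc (z - a) in za *.
have q0 : 0 <= q := normc_ge0 _.
have r0 : 0 < r by exact: le_lt_trans za.
have M0 : 0 <= M by apply: le_trans (normc_ge0 _) (gM z _); exact: lt_trans rr'.
(* margin beyond [0, 1] that keeps p s t in the disc of radius r' *)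
pose eta := (r' - r) / (4 * r).
have eta0 : 0 < eta by rewrite divr_gt0 ?mulr_gt0// subr_gt0.
have etar : eta * r = (r' - r) / 4 by rewrite /eta; field; lra.
have etaq : eta * q <= (r' - r) / 4 by rewrite -etar ler_pM2l// ltW.
pose p s t : C := z + s%:C * (circle_path a r t - z).
have pr' s t : - eta < s < 1 + eta -> nc (p s t - a) < r'.
  move=> /andP[s1 s2].
  have -> : p s t - a = (1 - s)%:C * (z - a) + s%:C * (circle_path a r t - a).
    by rewrite /p rmorphB rmorph1; ring.
  apply: le_lt_trans (le_normcD _ _) _.
  rewrite !Normc.normcM !normcR normc_circle_path ?(ltW r0)// -/q.
  have [s0|s0] := ltP s 0.
    rewrite (ltr0_norm s0) gtr0_norm; last by lra.
    have : (1 - s) * q <= (1 + eta) * q by rewrite ler_wpM2r//; lra.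
    have : - s * r <= eta * r by rewrite ler_wpM2r// ?ltW//; lra.
    by rewrite mulrDl mul1r; lra.
  have [s3|s3] := leP s 1.
    rewrite !ger0_norm; [|lra|lra].
    have : (1 - s) * q <= (1 - s) * r by rewrite ler_wpM2l ?(ltW za)//; lra.
    by rewrite mulrBl mul1r; lra.
  rewrite ltr0_norm; last by lra.
  rewrite gtr0_norm; last by lra.
  have : - (1 - s) * q <= eta * q by rewrite ler_wpM2r//; lra.
  have : s * r <= (1 + eta) * r by rewrite ler_wpM2r ?ltW.
  by rewrite mulrDl mul1r; lra.
pose F s t := cauchy_kernel a z r t * g (p s t).
pose F' s t := circle_speed r t * g' (p s t).
have dpt s t : is_curve_derive (p s) t (s%:C * circle_speed r t).
  have := is_curve_derive_affine s%:C (z - s%:C * z) (circle_path_derive a r t).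
  by rewrite (_ : (fun x => _) = p s)//; apply/funext => x; rewrite /p; ring.
have dgp s t : - eta < s < 1 + eta ->
    is_curve_derive (g \o p s) t (g' (p s t) * (s%:C * circle_speed r t)).
  by move=> us; apply: is_curve_derive_comp (dpt s t); apply: dg; exact: pr'.
have cF' s : - eta < s < 1 + eta -> continuous (F' s).
  move=> us t; have cpt := curve_derive_continuous (dpt s t).
  exact: (cvgM (@circle_speed_continuous _ r t) (cvg_comp (p s) g' cpt (cg' _ (pr' s t us)))).
have F'0 s : - eta < s < 1 + eta -> cintegral mu D (F' s) = 0.
  (* the primitive g (p s t) / s is lost at s = 0, where g' (p s t) is constant *)
  move=> us; have [s0|s0] := eqVneq s 0.
    apply: (@cintegral_derive_loop _ (fun t => g' z * circle_path a r t + 0)).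
    - exact: cF'.
    - move=> t; have := is_curve_derive_affine (g' z) 0 (circle_path_derive a r t).
      by rewrite (_ : g' z * _ = F' s t)// /F' s0 /p mul0r addr0 mulrC.
    - by rewrite circle_path_2pi.
  apply: (@cintegral_derive_loop _ (fun t => (s^-1)%:C * (g \o p s) t + 0)).
  - exact: cF'.
  - move=> t; have := is_curve_derive_affine (s^-1)%:C 0 (dgp s t us).
    rewrite (_ : (s^-1)%:C * (_ * _) = F' s t)// /F' mulrCA [X in _ * X]mulrA.
    by rewrite -rmorphM mulVf// mul1r mulrC.
  - by rewrite /= /p circle_path_2pi.
have FE : cintegral mu D (F 0) = cintegral mu D (F 1).
  apply: (@cintegral_homotopy _ F F' (- eta) (1 + eta) (r * M)) => //.
  - by rewrite oppr_lt0.
  - by rewrite ltrDl.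
  - move=> s t us.
    have := is_curve_derive_affine (circle_path a r t - z) z (is_curve_derive_real s).
    have -> : (fun x => (circle_path a r t - z) * x%:C + z) = p^~ t.
      by apply/funext => x; rewrite /p mulrC addrC.
    move/(@is_curve_derive_comp _ g (p^~ t) s _ _ (dg _ (pr' s t us))).
    move/(is_curve_derive_affine (cauchy_kernel a z r t) 0).
    under [X in is_curve_derive X]eq_fun do rewrite addr0.
    rewrite (_ : cauchy_kernel a z r t * _ = F' s t)// /F' /cauchy_kernel.
    rewrite mulr1 [g' _ * _]mulrC mulrA divfK//; exact: circle_path_neq.
  - move=> s us; apply: (@continuous_bounded_measurable _ _ _ (r / (r - q) * M)).
    + exact: measurable_period.
    + move=> t; have ct := curve_derive_continuous (dgp s t us).
      exact: (cvgM (@cauchy_kernel_continuous a z r za t) ct).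
    + move=> t; rewrite Normc.normcM; apply: ler_pM; rewrite ?normc_ge0//.
        exact: normc_cauchy_kernel.
      by apply: gM; exact: pr'.
  - move=> s t us; rewrite Normc.normcM normc_circle_speed ?(ltW r0)//.
    by rewrite ler_pM2l// g'M// pr'.
transitivity (cintegral mu D (F 1)).
  by congr cintegral; apply/funext => t; rewrite /F /p mul1r addrC subrK.
rewrite -FE [RHS]mulrC -(cintegral_cauchy_kernel za) -period_cintegralZ.
  by congr cintegral; apply/funext => t; rewrite /F /p mul0r addr0 mulrC.
exact: cauchy_kernel_bounded_measurable.
Qed.

End CauchyDisc.

(** * Integrals over boxes of tuples *)

Definition period_box (R : realType) n : set (n.-tuple (measurableTypeR R)) :=
  [set t | forall k, 0 <= (tnth t k : R) <= 2 * pi].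
Arguments period_box {R} n _ /.

Section TupleIntegral.
Context {R : realType}.
Local Notation C := R[i].
Local Notation nc := (@Normc.normc R).
Local Notation RM := (measurableTypeR R).
Local Notation box := (@period_box R).
Local Notation leb := (@lebesgue_measure R).
Local Notation D := (`[0, 2 * pi]%classic : set RM).

Lemma measurable_tuple_box n (A : 'I_n -> set RM) : (forall k, measurable (A k)) ->
  measurable [set t : n.-tuple RM | forall k, A k (tnth t k)].
Proof.
move=> mA; rewrite (_ : mkset _ = \bigcap_(k in [set: 'I_n])
    ((fun t : n.-tuple RM => tnth t k) @^-1` A k)); last first.
  by apply/seteqP; split => [t At k _|t At k]; [exact: At|exact: (At k)].
apply: fin_bigcap_measurable => // k _.
by rewrite -[X in measurable X]setTI; exact: measurable_tnth.
Qed.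

Lemma period_boxE n :
  box n = [set t | forall k, (fun=> D) k (tnth t k)].
Proof. by apply/seteqP; split => t bt k; have := bt k; rewrite /= in_itv. Qed.

Lemma measurable_period_box n : measurable (box n).
Proof. rewrite period_boxE; apply: (@measurable_tuple_box n (fun=> D)) => k.
exact: measurable_itv. Qed.

Lemma period_box_ltoo n : (lebesgue_tuple n (box n) < +oo :> \bar R)%E.
Proof.
rewrite period_boxE /lebesgue_tuple.
rewrite (@tuple_measure_box _ _ _ _ n (fun=> D)); last by move=> k; exact: measurable_itv.
have -> : (\prod_(i < n) leb D = ((2 * pi) ^+ n)%:E)%E.
  rewrite lebesgue_measure_itv/= lte_fin mulr_gt0 ?pi_gt0//= oppr0 addr0.
  elim: n => [|n IH]; first by rewrite big_ord0.
  by rewrite big_ord_recl IH exprS EFinM.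
exact: ltry.
Qed.

(** The measure on tuples of length n + 1 is the image of a product measure, so
this is Fubini's theorem; h is bounded everywhere to make each section
integrable. *)
Lemma Rintegral_tupleS n (h : n.+1.-tuple RM -> R) (M : R) :
  measurable_fun [set: n.+1.-tuple RM] h -> (forall t, `|h t| <= M) ->
  \int[lebesgue_tuple n.+1]_(t in box n.+1) h t =
  \int[lebesgue_tuple n]_(t in box n) \int[leb]_(x in D) h (cons_pair (x, t)).
Proof.
move=> mh hM; pose H := h \o @cons_pair _ RM n.
have mH : measurable_fun setT H.
  by apply: measurableT_comp => //; exact: measurable_cons_pair.
have boxE : @cons_pair _ RM n @^-1` box n.+1 = D `*` box n.
  apply/seteqP; split => [[x t] /= bxt|[x t] /= [xD bt] k].
    split => [|k]; first by rewrite in_itv/=; have := bxt ord0.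
    by have := bxt (lift ord0 k); rewrite tnthS.
  rewrite in_itv/= in xD.
  by case: (unliftP ord0 k) => [j ->|->]; rewrite ?tnthS ?tnth0.
have mbox : measurable (D `*` box n).
  by apply: measurableX; [exact: measurable_itv|exact: measurable_period_box].
have prod_ltoo : ((leb \x lebesgue_tuple n)%E (D `*` box n) < +oo)%E.
  rewrite product_measure1E; [|exact: measurable_itv|exact: measurable_period_box].
  apply: lte_mul_pinfty => //.
    by rewrite ge0_fin_numE//; exact: period_ltoo.
  exact: period_box_ltoo.
have iH : (leb \x lebesgue_tuple n)%E.-integrable (D `*` box n) (EFin \o H).
  apply: measurable_bounded_integrable => //; first exact: measurable_funTS.
  exists `|M|; split; rewrite ?num_real// => N MN x _.
  by apply: le_trans (hM _) _; apply: le_trans (ler_norm _) (ltW MN).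
rewrite {1}/Rintegral /lebesgue_tuple /= /cons_measure integral_pushforward; first last.
- exact: measurable_period_box.
- by rewrite boxE.
- exact/measurable_EFinP.
- exact: measurable_cons_pair.
rewrite boxE integral_mkcond -integral21_prod_meas1; last first.
  by rewrite -integrable_mkcond.
rewrite /Rintegral [in RHS]integral_mkcond; congr fine; apply: eq_integral => t _.
rewrite /fubini_G patchE; case: ifPn => [/set_mem bt|bt].
  rewrite fineK.
    rewrite [RHS]integral_mkcond; apply: eq_integral => x _.
    rewrite !patchE; case: ifPn => [/set_mem[/= xD _]|xt].
      by rewrite mem_set.
    rewrite ifN//; apply: contra xt => /set_mem xD; apply/mem_set; split => //.
  apply: integrable_fin_num; first exact: measurable_itv.
  apply: (@measurable_bounded_integrable _ RM R leb (fun x => h (cons_pair (x, t)))) => //.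
  - exact: period_ltoo.
  - apply: measurable_funTS; apply: measurableT_comp => //.
    exact: (measurable_cons (@measurable_id _ RM setT) (@measurable_cst _ _ RM (n.-tuple RM) setT t)).
  - exists `|M|; split; rewrite ?num_real// => N MN x _.
    by apply: le_trans (hM _) _; apply: le_trans (ler_norm _) (ltW MN).
apply: integral0_eq => x _; rewrite patchE ifN//.
by apply: contra bt => /set_mem[_ /= bt]; exact/mem_set.
Qed.

Lemma cintegral_tupleS n (h : n.+1.-tuple RM -> C) :
  bounded_measurable setT h ->
  cintegral (lebesgue_tuple n.+1) (box n.+1) h =
  cintegral (lebesgue_tuple n) (box n)
    (fun t => cintegral leb D (fun x => h (cons_pair (x, t)))).
Proof.
move=> [mR mI [M hM]]; congr (_ +i* _).
- apply: (@Rintegral_tupleS n (@complex.Re R \o h) M) => // t.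
  by apply: le_trans (normc_Re _) _; exact: hM.
- apply: (@Rintegral_tupleS n (@complex.Im R \o h) M) => // t.
  by apply: le_trans (normc_Im _) _; exact: hM.
Qed.

Lemma cintegral_tuple0 (h : 0.-tuple RM -> C) :
  cintegral (lebesgue_tuple 0) (box 0) h = h [tuple].
Proof.
have all0 (t : 0.-tuple RM) : t = [tuple] by rewrite tuple0.
have mh (k : 0.-tuple RM -> R) : measurable_fun setT k.
  rewrite (_ : k = cst (k [tuple])) //.
  by apply/funext => t; rewrite (all0 t).
have I (k : 0.-tuple RM -> R) : \int[lebesgue_tuple 0]_(t in box 0) k t = k [tuple].
  rewrite /Rintegral /lebesgue_tuple/= integral_dirac//; first last.
  - by apply/measurable_EFinP; apply: measurable_funTS.
  - exact: measurable_period_box.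
  by rewrite diracE mem_set ?mul1e// => -[].
by rewrite /cintegral !I; case: (h _).
Qed.

(** h is the pointwise limit of its composites with the rounding of the
coordinates to multiples of 1/(m + 1).  A rounded function is constant on
countably many half-open boxes, so it is measurable without any regularity
of h.  Sequential continuity suffices, which spares a topology on tuples. *)
Lemma seq_continuous_measurable n (h : n.-tuple R -> R) :
  (forall (u : nat -> n.-tuple R) t,
     (forall k, tnth (u m) k @[m --> \oo] --> tnth t k) ->
     h (u m) @[m --> \oo] --> h t) ->
  measurable_fun [set: n.-tuple RM] (h : n.-tuple RM -> R).
Proof.
move=> hc; pose grid m (q : n.-tuple int) : n.-tuple R :=
  [tuple (tnth q k)%:~R / m.+1%:R | k < n].
pose rnd m (t : n.-tuple R) : n.-tuple int :=
  [tuple Num.floor (tnth t k * m.+1%:R) | k < n].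
apply: (@measurable_fun_cvg _ _ _ setT (fun m => h \o grid m \o rnd m)); last first.
  move=> t _; apply: hc => k; apply/cvgrPdist_lt => e e0; near=> m.
  rewrite /grid /rnd !tnth_mktuple.
  have m0 : 0 < m.+1%:R :> R by [].
  have := Num.Theory.floor_itv (tnth t k * m.+1%:R).
  move=> /andP[]; set z := Num.floor _ => z1; rewrite intrD => z2.
  have em : e^-1 < m.+1%:R.
    by near: m; apply: filterS (nbhs_infty_gtr e^-1) => j /lt_trans; apply; rewrite ltr_nat.
  have -> : tnth t k - z%:~R / m.+1%:R = (tnth t k * m.+1%:R - z%:~R) / m.+1%:R.
    by rewrite mulrBl mulfK ?gt_eqF.
  rewrite ger0_norm; last by rewrite divr_ge0 ?subr_ge0.
  rewrite ltr_pdivrMr//; apply: (@lt_trans _ _ 1); first by rewrite ltrBlDl.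
  by rewrite -ltr_pdivrMl// mulr1.
move=> m _ Y mY; rewrite setTI.
have mgrid (q : n.-tuple int) : measurable [set t : n.-tuple RM | forall k,
    (fun k => [set x : RM | Num.floor ((x : R) * m.+1%:R) = tnth q k]) k (tnth t k)].
  apply: (@measurable_tuple_box n
    (fun k => [set x : RM | Num.floor ((x : R) * m.+1%:R) = tnth q k])) => k; rewrite (_ : mkset _ =
      `[(tnth q k)%:~R / m.+1%:R, (tnth q k + 1)%:~R / m.+1%:R[%classic).
    exact: measurable_itv.
  apply/seteqP; split => x; rewrite /= in_itv/= ler_pdivrMr// ltr_pdivlMr//
    -Num.Theory.floor_eq; first by move=> ->.
  by move/eqP.
rewrite (_ : _ @^-1` _ = \bigcup_(q : n.-tuple int)
    (if h (grid m q) \in Y then [set t | forall k,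
        (fun k => [set x : RM | Num.floor ((x : R) * m.+1%:R) = tnth q k]) k (tnth t k)]
     else set0)); last first.
  apply/seteqP; split => [t /= Yt|t [q _]].
    exists (rnd m t) => //; rewrite mem_set// => k /=.
    by rewrite tnth_mktuple.
  case: ifPn => // /set_mem Yq tq /=; suff -> : rnd m t = q by [].
  by apply: eq_from_tnth => k; rewrite tnth_mktuple; exact: tq.
apply: countable_bigcupT_measurable; first exact: countableP.
move=> q; case: ifPn => // _; exact: mgrid.
Unshelve. all: by end_near. Qed.

End TupleIntegral.

(** * Cauchy's formula on a polydisc *)

Definition ftail (X : Type) n (a : 'I_n.+1 -> X) (k : 'I_n) : X := a (lift ord0 k).

Section CauchyPolydisc.
Context {R : realType}.
Local Notation C := R[i].
Local Notation nc := (@Normc.normc R).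
Local Notation RM := (measurableTypeR R).
Local Notation leb := (@lebesgue_measure R).
Local Notation D := (`[0, 2 * pi]%classic : set RM).
Local Notation box := (@period_box R).

Definition torus_pt n (a : 'I_n -> C) (rho : 'I_n -> R) (t : n.-tuple R) : n.-tuple C :=
  [tuple circle_path (a k) (rho k) (tnth t k) | k < n].

Definition tset n (z : n.-tuple C) (k : 'I_n) (x : C) : n.-tuple C :=
  [tuple if j == k then x else tnth z j | j < n].

Definition tuple_polydisc n (a : 'I_n -> C) (rho : 'I_n -> R) : set (n.-tuple C) :=
  [set z | forall k, nc (tnth z k - a k) < rho k].

(** Joint continuity, in sequential form, makes G measurable on the torus; the
bounds on G and on its partial derivatives, and their continuity, are what
[cauchy_disc] needs on each slice.  All conditions pass to the slices in
which the first coordinate is fixed, as the induction in [cauchy_polydisc]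
requires. *)
Definition separately_holomorphic n (a : 'I_n -> C) (rho : 'I_n -> R)
    (G : n.-tuple C -> C) : Prop :=
  [/\ forall (u : nat -> n.-tuple C) z, (forall m, tuple_polydisc a rho (u m)) ->
        tuple_polydisc a rho z ->
        (forall k, tnth (u m) k @[m --> \oo] --> tnth z k) ->
        G (u m) @[m --> \oo] --> G z,
      exists M, forall z, tuple_polydisc a rho z -> nc (G z) <= M &
      forall k z, tuple_polydisc a rho z -> exists (g' : C -> C) (M : R),
        forall w, nc (w - a k) < rho k ->
          [/\ is_cderive (fun x => G (tset z k x)) w (g' w),
              {for w, continuous g'} & nc (g' w) <= M] ].

Lemma bounded_measurable_coord n (k : 'I_n) (f : R -> C) (M : R) :
  continuous f -> (forall t, nc (f t) <= M) ->
  bounded_measurable [set: n.-tuple RM] (fun t => f (tnth t k)).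
Proof.
move=> fc fM; have [mR mI _] := @continuous_bounded_measurable R f setT M measurableT fc fM.
split; last by exists M => t _; exact: fM.
- exact: (measurableT_comp mR (measurable_tnth k)).
- exact: (measurableT_comp mI (measurable_tnth k)).
Qed.

Lemma bounded_measurable_prod n d (T : measurableType d) (A : set T)
    (F : 'I_n -> T -> C) : measurable A -> (forall k, bounded_measurable A (F k)) ->
  bounded_measurable A (fun t => \prod_(k < n) F k t).
Proof.
move=> mA bF; elim: (index_enum _) => [|k s IH].
  rewrite (_ : (fun t => _) = cst 1); last by apply/funext => t; rewrite big_nil.
  exact: bounded_measurable_cst.
rewrite (_ : (fun t => _) = fun t => F k t * \prod_(j <- s) F j t); last first.
  by apply/funext => t; rewrite big_cons.
exact: bounded_measurableM.
Qed.

Lemma bounded_measurableT d (T : measurableType d) (A : set T) (f : T -> C) :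
  bounded_measurable setT f -> bounded_measurable A f.
Proof.
move=> [mR mI [M fM]]; split; [exact: measurable_funTS..|].
by exists M => t _; exact: fM.
Qed.

Lemma bounded_measurable_cauchy_kernels n (a : 'I_n -> C) (rho : 'I_n -> R)
    (z : n.-tuple C) : tuple_polydisc a rho z ->
  bounded_measurable [set: n.-tuple RM]
    (fun t => \prod_(k < n) cauchy_kernel (a k) (tnth z k) (rho k) (tnth t k)).
Proof.
move=> za; apply: bounded_measurable_prod => // k.
apply: (@bounded_measurable_coord _ k _ (rho k / (rho k - nc (tnth z k - a k)))).
  exact: cauchy_kernel_continuous (za k).
exact: normc_cauchy_kernel (za k).
Qed.

Lemma torus_pt_polydisc n (a : 'I_n -> C) (rho rho' : 'I_n -> R) t :
  (forall k, 0 <= rho k) -> (forall k, rho k < rho' k) ->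
  tuple_polydisc a rho' (torus_pt a rho t).
Proof. by move=> r0 rr k; rewrite tnth_mktuple normc_circle_path. Qed.

Lemma bounded_measurable_torus n (a : 'I_n -> C) (rho rho' : 'I_n -> R) G :
  (forall k, 0 <= rho k) -> (forall k, rho k < rho' k) ->
  separately_holomorphic a rho' G ->
  bounded_measurable [set: n.-tuple RM] (fun t => G (torus_pt a rho t)).
Proof.
move=> r0 rr [Gc [M GM] _].
have cG (u : nat -> n.-tuple R) (t : n.-tuple R) :
    (forall k, tnth (u m) k @[m --> \oo] --> tnth t k) ->
    G (torus_pt a rho (u m)) @[m --> \oo] --> G (torus_pt a rho t).
  move=> ut; apply: Gc => [m||k]; [exact: torus_pt_polydisc..|].
  have ct := @circle_path_continuous R (a k) (rho k) (tnth t k).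
  rewrite tnth_mktuple (_ : (fun m => tnth (torus_pt a rho (u m)) k) =
    circle_path (a k) (rho k) \o (fun m => tnth (u m) k)).
    exact: cvg_comp (ut k) ct.
  by apply/funext => m; rewrite tnth_mktuple.
split; last by exists M => t _; apply: GM; exact: torus_pt_polydisc.
- apply: (@seq_continuous_measurable R n (fun t => complex.Re (G (torus_pt a rho t)))).
  by move=> u t /cG /cvg_ReIm[].
- apply: (@seq_continuous_measurable R n (fun t => complex.Im (G (torus_pt a rho t)))).
  by move=> u t /cG /cvg_ReIm[].
Qed.

Lemma polydisc_cons n (a : 'I_n.+1 -> C) (rho : 'I_n.+1 -> R) (x : C) (z : n.-tuple C) :
  nc (x - a ord0) < rho ord0 ->
  tuple_polydisc (ftail a) (ftail rho) z ->
  tuple_polydisc a rho [tuple of x :: z].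
Proof.
by move=> xa za k; case: (unliftP ord0 k) => [j ->|->]; rewrite ?tnthS ?tnth0//; exact: za.
Qed.

Lemma separately_holomorphic_slice n (a : 'I_n.+1 -> C) (rho : 'I_n.+1 -> R) G (x : C) :
  separately_holomorphic a rho G -> nc (x - a ord0) < rho ord0 ->
  separately_holomorphic (ftail a) (ftail rho)
    (fun z : n.-tuple C => G [tuple of x :: z]).
Proof.
move=> [Gc [M GM] Gd] xa; split.
- move=> u z ud zd uz; apply: Gc => [m||k]; [exact: polydisc_cons..|].
  case: (unliftP ord0 k) => [j ->|->].
    by rewrite tnthS; under eq_cvg do rewrite tnthS; exact: uz.
  by rewrite tnth0; under eq_cvg do rewrite tnth0; exact: cvg_cst.
- by exists M => z zd; apply: GM; exact: polydisc_cons.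
- move=> k z zd; have [g' [M' h]] := Gd (lift ord0 k) _ (polydisc_cons xa zd).
  exists g', M' => w wa; have [h1 h2 h3] := h w wa; split; [|exact: h2|exact: h3].
  have -> : (fun y => G [tuple of x :: tset z k y]) =
            (fun y => G (tset [tuple of x :: z] (lift ord0 k) y)); last exact: h1.
  apply/funext => y; congr G; apply: eq_from_tnth => j; rewrite tnth_mktuple.
  by case: (unliftP ord0 j) => [i ->|->]; rewrite ?tnthS ?tnth0 ?tnth_mktuple.
Qed.

Lemma torus_pt_cons n (a : 'I_n.+1 -> C) (rho : 'I_n.+1 -> R) (x : R) (t : n.-tuple R) :
  torus_pt a rho [tuple of x :: t] =
  [tuple of circle_path (a ord0) (rho ord0) x ::
            torus_pt (ftail a) (ftail rho) t].
Proof.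
apply: eq_from_tnth => k; rewrite tnth_mktuple.
by case: (unliftP ord0 k) => [j ->|->]; rewrite ?tnthS ?tnth0 ?tnth_mktuple.
Qed.

(** By Fubini, the integral over the first coordinate can be evaluated first:
by the formula on a disc it replaces the first coordinate of the argument of
G by z_0 and leaves 2 pi i times an integral over the other coordinates. *)
Lemma cauchy_polydisc n (a : 'I_n -> C) (rho rho' : 'I_n -> R) (z : n.-tuple C) G :
  tuple_polydisc a rho z -> (forall k, rho k < rho' k) ->
  separately_holomorphic a rho' G ->
  cintegral (lebesgue_tuple n) (box n)
    (fun t => (\prod_(k < n) cauchy_kernel (a k) (tnth z k) (rho k) (tnth t k)) *
              G (torus_pt a rho t)) =
  (2 * pi%:C * (0 +i* 1)) ^+ n * G z.
Proof.
elim: n a rho rho' z G => [|n IH] a rho rho' z G za rr hG.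
  rewrite cintegral_tuple0 big_ord0 expr0; congr (_ * G _).
  by apply: eq_from_tnth => -[].
have r0 k : 0 <= rho k by apply: ltW; exact: le_lt_trans (normc_ge0 _) (za k).
case/tupleP: z za => z0 z za.
have z0a : nc (z0 - a ord0) < rho ord0 by have := za ord0; rewrite tnth0.
have za' : tuple_polydisc (ftail a) (ftail rho) z.
  by move=> k; have := za (lift ord0 k); rewrite tnthS.
rewrite cintegral_tupleS; last first.
  apply: bounded_measurableM; last exact: bounded_measurable_torus hG.
  exact: bounded_measurable_cauchy_kernels.
transitivity (cintegral (lebesgue_tuple n) (box n) (fun t => (2 * pi%:C * (0 +i* 1)) *
   ((\prod_(k < n) cauchy_kernel (ftail a k) (tnth z k) (ftail rho k) (tnth t k)) *
   G [tuple of z0 :: torus_pt (ftail a) (ftail rho) t]))).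
  apply: eq_cintegral => t _.
  set P := \prod_(k < n) cauchy_kernel (ftail a k) (tnth z k) (ftail rho k) (tnth t k).
  set tp := torus_pt (ftail a) (ftail rho) t.
  have tpd : tuple_polydisc (ftail a) (ftail rho') tp.
    by apply: torus_pt_polydisc => k; [exact: r0|exact: rr].
  have a0 : nc (a ord0 - a ord0) < rho' ord0.
    by rewrite subrr Normc.normc0; exact: le_lt_trans (rr ord0).
  have tsetE x y : tset [tuple of x :: tp] ord0 y = [tuple of y :: tp].
    apply: eq_from_tnth => k; rewrite tnth_mktuple.
    by case: (unliftP ord0 k) => [j ->|->]; rewrite ?tnthS ?tnth0.
  have [Gc [M GM] Gd] := hG.
  have [g' [M' hg']] := Gd ord0 _ (polydisc_cons a0 tpd).
  pose g x := G [tuple of x :: tp].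
  have dg w : nc (w - a ord0) < rho' ord0 -> is_cderive g w (g' w).
    move=> /hg'[+ _ _].
    by rewrite (_ : (fun x => _) = g)//; apply/funext => x; rewrite tsetE.
  have := @cauchy_disc _ g g' (a ord0) z0 (rho ord0) (rho' ord0) (Num.max M M') z0a (rr ord0).
  move=> CD.
  transitivity (cintegral leb D (fun x => P *
     (cauchy_kernel (a ord0) z0 (rho ord0) x * g (circle_path (a ord0) (rho ord0) x)))).
    apply: eq_cintegral => x _; rewrite big_ord_recl tnth0 torus_pt_cons -/tp /=.
    rewrite mulrCA mulrA; congr (_ * _ * _); apply: eq_bigr => k _.
    by rewrite !tnthS.
  rewrite period_cintegralZ; last first.
    apply: bounded_measurableM.
      exact: cauchy_kernel_bounded_measurable.
    apply: (@continuous_bounded_measurable _ _ _ M).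
    - exact: measurable_period.
    - move=> x; apply: (curve_derive_continuous (l := g' (circle_path (a ord0) (rho ord0) x) *
        circle_speed (rho ord0) x)).
      apply: is_curve_derive_comp; last exact: circle_path_derive.
      by apply: dg; rewrite normc_circle_path.
    - by move=> x; apply: GM; apply: polydisc_cons tpd; rewrite normc_circle_path.
  rewrite CD.
  - exact: mulrCA.
  - exact: dg.
  - by move=> w /hg'[].
  - by move=> w wa; rewrite le_max (GM _ (polydisc_cons wa tpd)).
  - by move=> w /hg'[_ _ h]; rewrite le_max h orbT.
have hGs := separately_holomorphic_slice hG (lt_trans z0a (rr ord0)).
rewrite cintegralZ.
- rewrite exprS -[RHS]mulrA; congr (_ * _).
  exact: (IH (ftail a) (ftail rho) (ftail rho') z (fun y => G [tuple of z0 :: y])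
    za' (fun k => rr _) hGs).
- exact: measurable_period_box.
- exact: period_box_ltoo.
- apply: bounded_measurableT; apply: bounded_measurableM.
    exact: (@bounded_measurable_cauchy_kernels n (ftail a) (ftail rho) z).
  apply: (@bounded_measurable_torus n (ftail a) (ftail rho) (ftail rho')
    (fun y => G [tuple of z0 :: y])) => // k; [exact: r0|exact: rr].
Qed.

End CauchyPolydisc.

(** * Compactness and the Cauchy criterion *)

Section ComplexTopology.
Context {R : realType}.
Local Notation C := R[i].
Local Notation nc := (@Normc.normc R).

Lemma nbhs_rowP d (z : 'rV[C]_d) (U : set 'rV[C]_d) :
  nbhs z U <-> exists2 e : R, 0 < e &
    forall u : 'rV[C]_d, (forall k, nc (u 0 k - z 0 k) < e) -> U u.
Proof.
split => [/nbhs_ballP[[e e'] /=]|[e e0 eU]].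
  rewrite ltcE/= => /andP[/eqP -> e0] eU; exists e => // u ue; apply: eU.
  split; first by rewrite ltcR.
  by move=> i k; rewrite ord1 -ball_normE/= normr_normc ltcR normcB.
apply/nbhs_ballP; exists e%:C; first by rewrite /= ltcR.
move=> u [_ ue]; apply: eU => k; have := ue 0 k.
by rewrite -ball_normE/= normr_normc ltcR normcB.
Qed.

Lemma compact_closed_disc (a : C) (r : R) : compact [set z : C | nc (z - a) <= r].
Proof.
pose f (p : R * R) : C := a + (p.1 +i* p.2).
have fc : continuous f.
  move=> p; apply/cvg_normcP => e e0; have e20 : 0 < e / 2 by rewrite divr_gt0.
  exists (ball p.1 (e / 2), ball p.2 (e / 2)); first by split; exact: nbhsx_ballx.
  move=> [x y] [/= hx hy]; rewrite /f opprD addrACA subrr add0r.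
  apply: le_lt_trans (normc_le_ReIm _) _; rewrite ReB ImB/= [e]splitr.
  by apply: ltrD; rewrite distrC; rewrite -ball_normE in hx hy.
apply: (@subclosed_compact _ _ [set f p | p in `[- r, r]%classic `*` `[- r, r]%classic]).
- move=> z clz /=; rewrite leNgt; apply/negP => rz.
  have e0 : 0 < nc (z - a) - r by rewrite subr_gt0.
  have nz : nbhs z [set y | nc (y - z) < nc (z - a) - r].
    by apply/nbhs_normcP; exists (nc (z - a) - r).
  have [y [/= ya yz]] := clz _ nz.
  have := le_normcD (z - y) (y - a); rewrite addrA subrK normcB; lra.
- apply: continuous_compact; first exact: continuous_subspaceT.
  by apply: compact_setX; exact: segment_compact.
- move=> z /= za; exists (complex.Re (z - a), complex.Im (z - a)); last first.
    by rewrite /f /=; case: (a) (z) => ? ? [? ?]; apply/eqP; rewrite eq_complex/= !subrKC !eqxx.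
  split; rewrite /= in_itv/= -ler_norml.
    exact: le_trans (normc_Re _) za.
  exact: le_trans (normc_Im _) za.
Qed.

Definition closed_polydisc d (w : 'rV[C]_d) (rho : 'I_d -> R) : set 'rV[C]_d :=
  [set z | forall k, nc (z 0 k - w 0 k) <= rho k].

Lemma compact_closed_polydisc d (w : 'rV[C]_d) (rho : 'I_d -> R) :
  compact (closed_polydisc w rho).
Proof.
exact: (@rV_compact C d (fun k => [set x | nc (x - w 0 k) <= rho k])
  (fun k => @compact_closed_disc (w 0 k) (rho k))).
Qed.

Lemma compact_bounded_normc {T : topologicalType} (K : set T) (g : T -> C) :
  compact K -> (forall z, K z -> {for z, continuous g}) ->
  exists M, forall z, K z -> nc (g z) <= M.
Proof.
move=> /compact_near_coveringP Kc gc.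
have [|N _ /(_ N (leqnn N)) KN] := Kc nat \oo (fun n z => nc (g z) <= n%:R) _; last by exists N%:R.
move=> z Kz; have /cvg_normcP/(_ 1 ltr01) h := gc z Kz.
exists ([set u | nc (g u - g z) < 1], [set n | nc (g z) + 1 <= n%:R]).
  by split; [exact: h|exact: nbhs_infty_ger].
move=> [u n] [/= hu hn]; apply: le_trans hn.
have := le_normcD (g u - g z) (g z); rewrite subrK; lra.
Qed.

(** For u near z, g u = g z + (g u - g z) with g z in t W and g u - g z in W,
hence g u in (t + 1) W; compactness makes t uniform. *)
Lemma compact_bounded_tvs {T : topologicalType} {E : tvsType C} (K : set T) (g : T -> E) :
  compact K -> (forall z, K z -> {for z, continuous g}) ->
  tvs_bounded [set g z | z in K].
Proof.
move=> /compact_near_coveringP Kc gc U U0.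
have [W [cW W0 WU]] := nbhs0_absolutely_convex U0.
have [|N _ KN] := Kc nat \oo (fun n z => exists2 y, W y & g z = n.+1%:R%:C *: y) _.
  move=> z Kz; have /cvg_tvsP/(_ _ W0) h := gc z Kz.
  have [t t0 [y Wy gzy]] := nbhs0_absorbing (g z) W0.
  exists ([set u | W (g u - g z)], [set n | t + 1 <= n%:R]).
    by split; [exact: h|exact: nbhs_infty_ger].
  move=> [u n] [/= hu hn].
  have tn : t + 1 <= n.+1%:R by apply: le_trans hn _; rewrite ler_nat.
  have n0 : 0 < n.+1%:R :> R by [].
  exists ((t / n.+1%:R)%:C *: y + (1 / n.+1%:R)%:C *: (g u - g z)).
    apply: cW.2 => //; rewrite !normr_normc !normcR -rmorphD/= lecR.
    rewrite !gtr0_norm ?divr_gt0// -mulrDl ler_pdivrMr// mul1r//.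
  rewrite scalerDr !scalerA -!rmorphM/= ![n.+1%:R * _]mulrC !divfK ?gt_eqF//.
  by rewrite -gzy scale1r addrC subrK.
exists N.+1%:R => // _ [z Kz <-]; have [y Wy ->] := KN N (leqnn N) z Kz.
by exists y => //; exact: WU.
Qed.

Lemma cauchy_cvg_dnbhs (p : C -> C) :
  (forall e : R, 0 < e -> exists2 d : R, 0 < d &
     forall h k, h != 0 -> k != 0 -> nc h < d -> nc k < d -> nc (p h - p k) < e) ->
  exists l : C, p h @[h --> (0 : C)^'] --> l.
Proof.
move=> pc.
have cv (q : C -> R) : (forall h k, `|q h - q k| <= nc (p h - p k)) ->
    exists l : R, q h @[h --> (0 : C)^'] --> l.
  move=> qp; apply/cvg_ex; apply/cauchy_cvgP; apply/cauchy_ballP => e e0.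
  have [d d0 dp] := pc e e0.
  exists ([set x | exists h, [/\ h != 0, nc h < d & x = q h]],
          [set x | exists h, [/\ h != 0, nc h < d & x = q h]]) => /=.
    by split; apply/dnbhs_normcP; exists d => // h h0 hd; exists h.
  move=> [_ _] [/= [h [h0 hd ->]] [k [k0 kd ->]]].
  by rewrite -ball_normE/=; apply: le_lt_trans (qp _ _) _; exact: dp.
have [|x px] := cv (fun h => complex.Re (p h)); first by move=> h k; rewrite -ReB normc_Re.
have [|y py] := cv (fun h => complex.Im (p h)); first by move=> h k; rewrite -ImB normc_Im.
by exists (x +i* y); apply/cvg_ReIm.
Qed.

End ComplexTopology.

(** * Weak holomorphy of vector-valued functions *)

Section WeakHolomorphy.
Context {R : realType} {d : nat} {E F : tvsType R[i]} {iota : {linear E -> F}}.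
Local Notation C := R[i].
Local Notation nc := (@Normc.normc R).
Local Notation Cd := 'rV[C]_d.
Variables (Omega : set Cd) (f : Cd -> E).
Hypotheses (Omega_open : open Omega) (iota_emb : tvs_embedding iota)
  (f_holo : holomorphic iota Omega f).

Definition diff_quotient (j : 'I_d) (z : Cd) (h : C) : E :=
  h^-1 *: (f (z + h *: delta_mx 0 j) - f z).

Lemma eucl_norm_delta (j : 'I_d) (h : C) : eucl_norm (h *: delta_mx 0 j) = nc h.
Proof.
rewrite /eucl_norm (bigD1 j)//= big1 => [|k kj].
  by rewrite addr0 !mxE !eqxx mulr1 sqrtr_sqr ger0_norm// normc_ge0.
by rewrite !mxE (negPf kj) andbF mulr0 Normc.normc0 expr0n.
Qed.

Lemma near_along_delta (j : 'I_d) (z : Cd) (P : set Cd) : z^' P ->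
  \forall h \near (0 : C)^', P (z + h *: delta_mx 0 j).
Proof.
move=> /nbhs_rowP[e e0 eP]; apply/dnbhs_normcP; exists e => // h h0 he.
apply: eP => [k|].
  rewrite !mxE addrAC subrr add0r Normc.normcM.
  by case: (_ && _); rewrite ?Normc.normc1 ?mulr1// Normc.normc0 mulr0.
apply/eqP => /(congr1 (fun u : Cd => u 0 j)); rewrite !mxE !eqxx mulr1.
by move/eqP; rewrite -subr_eq0 addrAC subrr add0r (negPf h0).
Qed.

Lemma cvg_diff_quotient (df : Cd -> {linear Cd -> F}) (j : 'I_d) (z : Cd) :
  Omega z ->
  ((eucl_norm (u - z))^-1%:C *: (iota (f u) - iota (f z) - df z (u - z)))
    @[u --> within Omega z^'] --> (0 : F) ->
  iota (diff_quotient j z h) @[h --> (0 : C)^'] --> df z (delta_mx 0 j).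
Proof.
move=> Oz dfz; apply/cvg_tvsP => U U0.
have [W [cW W0 WU]] := nbhs0_absolutely_convex U0.
move/cvg_tvsP/(_ _ W0) : dfz => dfz.
have {}dfz : \forall h \near (0 : C)^', Omega (z + h *: delta_mx 0 j) ->
    W ((nc h)^-1%:C *: (iota (f (z + h *: delta_mx 0 j)) - iota (f z)
        - df z (h *: delta_mx 0 j))).
  have dfz' := near_along_delta j dfz; apply: filterS dfz' => h /= Wh Oh.
  have := Wh Oh; rewrite subr0 addrAC subrr add0r eucl_norm_delta; exact.
have Oh : \forall h \near (0 : C)^', Omega (z + h *: delta_mx 0 j).
  have : z^' Omega by apply: nbhs_dnbhs; exact: open_nbhs_nbhs.
  exact: near_along_delta.
have h0 : \forall h \near (0 : C)^', h != 0 by apply: nbhs_dnbhs_neq.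
near=> h; apply: WU.
have hn : h != 0 by near: h.
have Wh : W ((nc h)^-1%:C *: (iota (f (z + h *: delta_mx 0 j)) - iota (f z)
        - df z (h *: delta_mx 0 j))).
  by near: h; apply: filterS2 dfz Oh => h; exact.
have ncn : (nc h)%:C != 0 :> C by rewrite (inj_eq (@complexI _)) gt_eqF// normc_gt0.
rewrite (_ : _ - _ = (h^-1 * (nc h)%:C) *: ((nc h)^-1%:C *:
    (iota (f (z + h *: delta_mx 0 j)) - iota (f z) - df z (h *: delta_mx 0 j)))); last first.
  rewrite scalerA -mulrA -rmorphM/= mulfV ?normc_eq0// mulr1.
  by rewrite /diff_quotient linearZ linearB/= [df z (h *: _)]linearZ/= [in RHS]scalerBr scalerA mulVf// scale1r.
rewrite -[X in W X]addr0 -(scale0r (0 : F)); apply: cW.2 => //; first exact: nbhs_singleton.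
rewrite normr0 addr0 normr_normc Normc.normcM Normc.normcV normcR ger0_norm ?normc_ge0//.
by rewrite mulVf ?normc_eq0// lexx.
Unshelve. all: by end_near. Qed.

(** In the completion, both quotients are close to df at their base points, and
df is continuous; the embedding brings the closeness back to E. *)
Lemma near_diff_quotient (j : 'I_d) (z : Cd) (U : set E) : Omega z -> nbhs 0 U ->
  \forall z' \near z, exists2 e : R, 0 < e & forall h h' : C,
    h != 0 -> nc h < e -> h' != 0 -> nc h' < e ->
    U (diff_quotient j z h - diff_quotient j z' h').
Proof.
move=> Oz U0; have [df [dfl dfc]] := f_holo.
have [_ iotaU] := iota_emb; have [V V0 VU] := (iotaU U).1 U0.
(* the difference is split into three terms, in V2 + (V2 + V2) *)
have [V1 V10 V1V] := nbhs0_half V0; have [V2' V20 V2V1] := nbhs0_half V10.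
have [V2 [cV2 V2_0 V2V2']] := nbhs0_absolutely_convex V20.
have V2N x : V2 x -> V2 (- x).
  move=> Vx; rewrite -scaleN1r -[_ *: x]addr0 -(scale0r x); apply: cV2.2 => //.
  by rewrite normrN1 normr0 addr0.
have V2V1' x : V2 x -> V1 x.
  move=> /V2V2' Vx; rewrite -[x]addr0; apply: V2V1 => //; exact: nbhs_singleton.
have near_df z' : Omega z' -> exists2 e : R, 0 < e & forall h : C, h != 0 -> nc h < e ->
    V2 (iota (diff_quotient j z' h) - df z' (delta_mx 0 j)).
  move=> Oz'; have /cvg_tvsP/(_ _ V2_0)/dnbhs_normcP := cvg_diff_quotient (j := j) Oz' (dfl z' Oz').
  by [].
have dfcz : df u (delta_mx 0 j) @[u --> z] --> df z (delta_mx 0 j).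
  by have := dfc (delta_mx 0 j); rewrite continuous_open_subspace// => /(_ z); rewrite inE; exact.
move/cvg_tvsP/(_ _ V2_0) : dfcz => dfcz.
have Onear : nbhs z Omega by exact: open_nbhs_nbhs.
near=> z'.
have Oz' : Omega z' by near: z'.
have Vz' : V2 (df z' (delta_mx 0 j) - df z (delta_mx 0 j)) by near: z'.
have [e e0 he] := near_df z Oz; have [e' e'0 he'] := near_df z' Oz'.
exists (Num.min e e'); first by rewrite lt_min e0.
move=> h h' h0; rewrite lt_min => /andP[hle _] h'0; rewrite lt_min => /andP[_ h'le].
apply: VU; rewrite /= linearB.
have -> : iota (diff_quotient j z h) - iota (diff_quotient j z' h') =
  (iota (diff_quotient j z h) - df z (delta_mx 0 j)) +
  (- (df z' (delta_mx 0 j) - df z (delta_mx 0 j)) +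
   - (iota (diff_quotient j z' h') - df z' (delta_mx 0 j))).
  by rewrite !opprB (addrA (df z (delta_mx 0 j) - df z' (delta_mx 0 j))) subrK addrA subrK.
apply: V1V; first by apply: V2V1'; exact: he.
by apply: V2V1; apply: V2V2'; apply: V2N => //; exact: he'.
Unshelve. all: by end_near. Qed.

(** In the completion, f u - f z is the remainder plus df z (u - z).  The
linear part is small because df z is determined by finitely many vectors. *)
Lemma holomorphic_continuous (z : Cd) : Omega z -> {for z, continuous f}.
Proof.
move=> Oz; apply/(@cvg_tvsP _ _ _ (nbhs z) _ f (f z)) => U U0.
have [df [dfl _]] := f_holo.
have [_ iotaU] := iota_emb; have [V V0 VU] := (iotaU U).1 U0.
have [V1' V10 V1V] := nbhs0_half V0.
have [V1 [cV1 V1_0 V1V1']] := nbhs0_absolutely_convex V10.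
have [gD _] := gauge_sublinear cV1 V1_0.
have V1z : V1 0 by exact: nbhs_singleton.
have /cvg_tvsP/(_ _ V1_0) dfz := dfl z Oz.
have Onear : nbhs z Omega by exact: open_nbhs_nbhs.
pose T := \sum_(k < d) gauge V1 (df z (delta_mx 0 k)).
have gauge_ge0 x : 0 <= gauge V1 x.
  apply: lb_le_inf => [|t [/ltW//]].
  by have [t t0 [v Wv ->]] := nbhs0_absorbing x V1_0; exists t; split => //; exists v.
have T0 : 0 <= T by apply: sumr_ge0.
(* 1/(T + 1) keeps the gauge of df z (u - z) below 1; 1/(d + 1) keeps the
   norm of u - z, which multiplies the remainder, at most 1 *)
have eu : nbhs z [set u : Cd | forall k, nc (u 0 k - z 0 k) < Num.min (T + 1)^-1 (d.+1%:R)^-1].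
  apply/nbhs_rowP; exists (Num.min (T + 1)^-1 (d.+1%:R)^-1) => //.
  by rewrite lt_min !invr_gt0 ltr0n andbT; lra.
near=> u; apply: VU; rewrite /= linearB.
have [->|uz] := eqVneq u z; first by rewrite subrr; exact: nbhs_singleton.
have ev : forall k, nc (u 0 k - z 0 k) < Num.min (T + 1)^-1 (d.+1%:R)^-1 by near: u.
have Wu : V1 ((eucl_norm (u - z))^-1%:C *: (iota (f u) - iota (f z) - df z (u - z)) - 0).
  have hu : u != z -> Omega u ->
      V1 ((eucl_norm (u - z))^-1%:C *: (iota (f u) - iota (f z) - df z (u - z)) - 0).
    by near: u; exact: dfz.
  by apply: hu => //; near: u.
rewrite subr0 in Wu.
have -> : iota (f u) - iota (f z) = (iota (f u) - iota (f z) - df z (u - z)) + df z (u - z).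
  by rewrite subrK.
have en0 : 0 <= eucl_norm (u - z) by exact: sqrtr_ge0.
apply: V1V; apply: V1V1'.
  have [e0|e0] := eqVneq (eucl_norm (u - z)) 0.
    exfalso; move/eqP: uz; apply; apply/rowP => k; apply/eqP; rewrite -subr_eq0.
    move/eqP: e0; rewrite sqrtr_eq0 => e0.
    have := le_trans (_ : nc (u 0 k - z 0 k) ^+ 2 <= _) e0.
    rewrite (bigD1 k)//= !mxE => h; rewrite -normc_eq0 -sqrf_eq0 eq_le sqr_ge0 andbT h//.
    by rewrite lerDl sumr_ge0// => i _; exact: sqr_ge0.
  have e1 : eucl_norm (u - z) <= 1.
    rewrite -[leRHS]sqrtr1 ler_wsqrtr//.
    apply: le_trans (_ : \sum_(k < d) (d.+1%:R)^-1 <= _) => [|].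
      apply: ler_sum => k _; rewrite !mxE.
      have := ev k; rewrite lt_min => /andP[_ h].
      have h1 : (d.+1%:R)^-1 <= 1 :> R by rewrite invf_le1// ler1n.
      rewrite expr2; apply: le_trans (ler_piMr _ _) (ltW h) => //; first exact: normc_ge0.
      exact: le_trans (ltW h) h1.
    rewrite sumr_const card_ord -[X in X <= _]mulr_natl ler_pdivrMr ?ltr0n// mul1r ler_nat//.
  rewrite -[X in V1 X](scale1r) -(rmorph1 (real_complex R)) -(mulfV e0) rmorphM -scalerA.
  rewrite -[X in V1 X]addr0 -(scale0r (0 : F)); apply: cV1.2 => //.
  by rewrite normr0 addr0 normr_normc normcR lecR ger0_norm.
apply: gauge_lt1 => //.
rewrite [u - z]row_sum_delta linear_sum/=.
have gsum : gauge V1 (\sum_(k < d) df z ((u - z) 0 k *: delta_mx 0 k)) <=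
    \sum_(k < d) (T + 1)^-1 * gauge V1 (df z (delta_mx 0 k)).
  elim/big_rec2: _ => [|k x y _ yx].
    by rewrite leNgt; apply/negP => g0; have := @gauge_le _ _ V1 _ 0 (divr_gt0 g0 (ltr0Sn R 1)) V1z;
      rewrite scaler0; lra.
  apply: le_trans (gD _ _) _; apply: lerD => //.
  rewrite linearZ/=; apply: le_trans (gaugeZ_le _ _ cV1 V1_0) _.
  rewrite ler_wpM2r// !mxE; apply: ltW.
  by have := ev k; rewrite lt_min => /andP[].
apply: le_lt_trans gsum _; rewrite -mulr_sumr -/T mulrC ltr_pdivrMr; lra.
Unshelve. all: by end_near. Qed.

Lemma normc_lim_le (p q : C -> C) (l m : C) (e : R) :
  p h @[h --> (0 : C)^'] --> l -> q h @[h --> (0 : C)^'] --> m ->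
  (\forall h \near (0 : C)^', nc (p h - q h) <= e) -> nc (l - m) <= e.
Proof.
move=> /cvg_normcP pl /cvg_normcP qm pq; apply/ler_addgt0Pr => eta eta0.
have e20 : 0 < eta / 2 by rewrite divr_gt0.
near (0 : C)^' => h.
have h1 : nc (p h - l) < eta / 2 by near: h; exact: pl.
have h2 : nc (q h - m) < eta / 2 by near: h; exact: qm.
have h3 : nc (p h - q h) <= e by near: h.
have -> : l - m = (l - p h) + ((p h - q h) + (q h - m)).
  by ring.
apply: le_trans (le_normcD _ _) _; rewrite normcB.
have := le_normcD (p h - q h) (q h - m); lra.
Unshelve. all: by end_near. Qed.

(** The quotients at z are close to each other and to those at nearby points:
this is the Cauchy criterion for the existence of the limit in the scalars,
and then the continuity of the limit. *)
Lemma weak_partial (phi : {scalar E}) (j : 'I_d) : continuous phi ->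
  exists L : Cd -> C, forall z, Omega z ->
    phi (diff_quotient j z h) @[h --> (0 : C)^'] --> L z /\ {for z, continuous L}.
Proof.
move=> cphi.
have phi0 (e : R) : 0 < e -> nbhs (0 : E) [set x | nc (phi x) < e].
  move=> e0; have /cvg_normcP/(_ _ e0) := cphi 0; apply: filterS => x.
  by rewrite linear0 subr0.
have ex z : exists l : C, Omega z -> phi (diff_quotient j z h) @[h --> (0 : C)^'] --> l.
  have [Oz|nOz] := pselect (Omega z); last by exists 0.
  have [|l pl] := @cauchy_cvg_dnbhs R (fun h => phi (diff_quotient j z h)); last by exists l.
  move=> e e0; have [d0 d0_gt0 dP] := nbhs_singleton (near_diff_quotient j Oz (phi0 e e0)).
  by exists d0 => // h k h0 k0 hd kd; rewrite -linearB; exact: dP.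
have [L LP] := choice ex; exists L => z Oz; split; first exact: LP.
apply/(@cvg_normcP _ _ (nbhs z) _ L (L z)) => e e0.
have e20 : 0 < e / 2 by rewrite divr_gt0.
have Onear : nbhs z Omega by exact: open_nbhs_nbhs.
apply: filterS2 Onear (near_diff_quotient j Oz (phi0 _ e20)) => z' Oz' [eta eta0 etaP].
rewrite normcB; apply: le_lt_trans (_ : _ <= e / 2) _; last by lra.
apply: normc_lim_le (LP z Oz) (LP z' Oz') _; apply/dnbhs_normcP; exists eta => // h h0 he.
by rewrite -linearB ltW//; exact: etaP.
Qed.

(** The closed polydisc is compact, which provides the bounds. *)
Lemma weakly_separately_holomorphic (phi : {scalar E}) (w : Cd) (rho : 'I_d -> R) :
  continuous phi -> closed_polydisc w rho `<=` Omega ->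
  separately_holomorphic (fun k => w 0 k) rho
    (fun t : d.-tuple C => phi (f (\row_k tnth t k))).
Proof.
move=> cphi wO.
have cphif z : Omega z -> {for z, continuous (phi \o f)}.
  move=> Oz; have cf := holomorphic_continuous Oz.
  exact: (@continuous_comp _ _ _ f phi z cf (cphi (f z))).
have tO t : tuple_polydisc (fun k => w 0 k) rho t -> closed_polydisc w rho (\row_k tnth t k).
  by move=> tr k; rewrite mxE; exact: ltW.
have Kc := @compact_closed_polydisc R d w rho.
split.
- move=> u z ud zd uz; apply/cvg_normcP => e e0.
  have := cphif _ (wO _ (tO _ zd)).
  move=> /(@cvg_normcP _ _ (nbhs (\row_k tnth z k)) _ (phi \o f) _)/(_ _ e0)/nbhs_rowP[eta eta0 etaP].
  have : \forall m \near \oo, forall k, nc (tnth (u m) k - tnth z k) < eta.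
    by apply: filter_forall => k; have /cvg_normcP := uz k; exact.
  by apply: filterS => m um; apply: etaP => k; rewrite !mxE.
- have [M MP] := @compact_bounded_normc R _ (closed_polydisc w rho) (phi \o f) Kc
    (fun z Kz => cphif z (wO z Kz)).
  by exists M => z zd; apply: MP; exact: tO.
- move=> k z zd; have [L LP] := weak_partial k cphi.
  have [M MP] := @compact_bounded_normc R _ (closed_polydisc w rho) L Kc
    (fun z Kz => (LP z (wO z Kz)).2).
  exists (fun x => L (\row_j tnth (tset z k x) j)), M => x xk.
  have xd : tuple_polydisc (fun k => w 0 k) rho (tset z k x).
    by move=> j; rewrite tnth_mktuple; case: eqP => [->|_].
  have [Ld Lc] := LP _ (wO _ (tO _ xd)).
  split; last exact: MP (tO _ xd).
  + rewrite /is_cderive.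
    have -> : (fun h => h^-1 * (phi (f (\row_j tnth (tset z k (x + h)) j)) -
                 phi (f (\row_j tnth (tset z k x) j)))) =
              (fun h => phi (diff_quotient k (\row_j tnth (tset z k x) j) h)).
      apply/funext => h; rewrite /diff_quotient linearZ linearB; congr (_ * (phi (f _) - _)).
      apply/rowP => j; rewrite !mxE !tnth_mktuple eqxx/=.
      by case: eqP => _; rewrite ?mulr1// mulr0 addr0.
    exact: Ld.
  + apply/(@cvg_normcP _ _ (nbhs x) _ _ _) => e e0.
    move: Lc => /(@cvg_normcP _ _ (nbhs _) _ L _)/(_ _ e0)/nbhs_rowP[eta eta0 etaP].
    apply/nbhs_normcP; exists eta => // y yx; apply: etaP => j.
    by rewrite !mxE !tnth_mktuple; case: eqP => // _; rewrite subrr Normc.normc0.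
Qed.

End WeakHolomorphy.

(** * Derivatives of the Cauchy kernel *)

Section CauchyKernelDerivatives.
Context {R : realType}.
Local Notation C := R[i].
Local Notation nc := (@Normc.normc R).

(** The m-th derivative in z of 1/(x - z), at z = 0. *)
Definition pole (m : nat) (x : C) : C := m`!%:R * x^-1 ^+ m.+1.

(** With a = 1/x and b = 1/(x - h) one has b - a = h a b, so each step of the
induction on m multiplies the error of the previous one by b and adds two
terms with a factor b - a. *)
Lemma inv_power_quotient (m : nat) (M : R) : 0 <= M -> exists2 K : R, 0 <= K &
  forall x h : C, x != 0 -> x - h != 0 -> h != 0 -> nc x^-1 <= M -> nc (x - h)^-1 <= M ->
    nc (h^-1 * ((x - h)^-1 ^+ m - x^-1 ^+ m) - m%:R * x^-1 ^+ m.+1) <= K * nc h.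
Proof.
move=> M0; elim: m => [|m [K K0 IH]].
  exists 0 => // x h _ _ _ _ _; rewrite !expr0 subrr mulr0 mul0r subr0.
  by rewrite Normc.normc0 mul0r.
exists (M * K + M * (m%:R * M ^+ m.+1) * M + M ^+ m.+2 * M).
  have MX n : 0 <= M ^+ n by exact: exprn_ge0.
  apply: addr_ge0; last exact: mulr_ge0.
  apply: addr_ge0; first exact: mulr_ge0.
  by apply: mulr_ge0 => //; apply: mulr_ge0 => //; exact: mulr_ge0.
move=> x h x0 xh h0 xM xhM; set a := x^-1 in xM *; set b := (x - h)^-1 in xhM *.
have ba : b - a = h * (a * b) by rewrite /a /b; field; rewrite xh x0.
set q := h^-1 * (b ^+ m - a ^+ m) - m%:R * a ^+ m.+1.
have qK : nc q <= K * nc h by exact: IH.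
have -> : h^-1 * (b ^+ m.+1 - a ^+ m.+1) - m.+1%:R * a ^+ m.+2 =
    b * q + (b - a) * (m%:R * a ^+ m.+1) + h^-1 * (b - a) * a ^+ m - a ^+ m.+2.
  by rewrite /q !exprS -[m.+1]addn1 natrD; ring.
have -> : h^-1 * (b - a) * a ^+ m = a * b * a ^+ m by rewrite ba mulKf.
have -> : b * q + (b - a) * (m%:R * a ^+ m.+1) + a * b * a ^+ m - a ^+ m.+2 =
    b * q + (b - a) * (m%:R * a ^+ m.+1) + (b - a) * a ^+ m.+1.
  by rewrite !exprS; ring.
have nba : nc (b - a) <= nc h * (M * M).
  by rewrite ba !Normc.normcM ler_wpM2l ?normc_ge0// ler_pM ?normc_ge0.
have nam : nc (a ^+ m.+1) <= M ^+ m.+1.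
  by rewrite normcX lerXn2r ?nnegrE ?normc_ge0.
apply: le_trans (le_normcD _ _) _; apply: le_trans (lerD (le_normcD _ _) (lexx _)) _.
rewrite !Normc.normcM.
have t1 : nc b * nc q <= M * (K * nc h) by rewrite ler_pM ?normc_ge0.
have nm : nc (m%:R : C) = m%:R by rewrite -(rmorph_nat (real_complex R)) normcR ger0_norm.
have t2 : nc (b - a) * (nc (m%:R : C) * nc (a ^+ m.+1)) <= nc h * (M * M) * (m%:R * M ^+ m.+1).
  by rewrite nm ler_pM ?normc_ge0 ?mulr_ge0 ?normc_ge0// ler_wpM2l.
have t3 : nc (b - a) * nc (a ^+ m.+1) <= nc h * (M * M) * M ^+ m.+1.
  by rewrite ler_pM ?normc_ge0.
apply: le_trans (lerD (lerD t1 t2) t3) _.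
rewrite le_eqVlt; apply/orP; left; apply/eqP; rewrite [M ^+ m.+2]exprS; ring.
Qed.

Lemma pole_quotient (m : nat) (M : R) : 0 <= M -> exists2 K : R, 0 <= K &
  forall x h : C, x != 0 -> x - h != 0 -> h != 0 -> nc x^-1 <= M -> nc (x - h)^-1 <= M ->
    nc (h^-1 * (pole m (x - h) - pole m x) - pole m.+1 x) <= K * nc h.
Proof.
move=> M0; have [K K0 KP] := inv_power_quotient m.+1 M0.
exists (m`!%:R * K); first by rewrite mulr_ge0.
move=> x h x0 xh h0 xM xhM.
have -> : h^-1 * (pole m (x - h) - pole m x) - pole m.+1 x =
    m`!%:R * (h^-1 * ((x - h)^-1 ^+ m.+1 - x^-1 ^+ m.+1) - m.+1%:R * x^-1 ^+ m.+2).
  by rewrite /pole factS natrM; ring.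
rewrite Normc.normcM -(rmorph_nat (real_complex R)) normcR ger0_norm//.
by rewrite -mulrA ler_wpM2l// KP.
Qed.

Lemma normc_pole (m : nat) (M : R) (x : C) : 0 <= M -> nc x^-1 <= M ->
  nc (pole m x) <= m`!%:R * M ^+ m.+1.
Proof.
move=> M0 xM; rewrite Normc.normcM -(rmorph_nat (real_complex R)) normcR ger0_norm//.
by rewrite ler_wpM2l// normcX lerXn2r ?nnegrE ?normc_ge0.
Qed.

End CauchyKernelDerivatives.

Section TorusKernel.
Context {R : realType} {d : nat}.
Local Notation C := R[i].
Local Notation nc := (@Normc.normc R).
Local Notation Cd := 'rV[C]_d.
Local Notation RM := (measurableTypeR R).
Variables (w : Cd) (rho : 'I_d -> R).

(** The m-th derivative in z of the Cauchy kernel of the polydisc, with the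
differential of the path t |-> torus_path w rho t included. *)
Definition torus_kernel (m : 'I_d -> nat) (z : Cd) (t : d.-tuple R) : C :=
  \prod_(k < d) (circle_speed (rho k) (tnth t k) *
    pole (m k) (circle_path (w 0 k) (rho k) (tnth t k) - z 0 k)).

Definition mindex_succ (m : 'I_d -> nat) (j : 'I_d) : 'I_d -> nat :=
  fun k => (m k + (k == j))%N.

Local Notation P := (polydisc w (EFin \o rho)).

Lemma polydiscP (z : Cd) : P z <-> forall k, nc (z 0 k - w 0 k) < rho k.
Proof. by split => Pz k; have := Pz k; rewrite /= lte_fin. Qed.

Lemma pole_circle_continuous (m : nat) (a z : C) (r : R) : nc (z - a) < r ->
  continuous (fun t => circle_speed r t * pole m (circle_path a r t - z)).
Proof.
move=> za t; have ic := @inv_circle_path_continuous R a z r za t.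
suff h n : (circle_path a r x - z)^-1 ^+ n @[x --> t] --> (circle_path a r t - z)^-1 ^+ n.
  exact: (cvgM (@circle_speed_continuous R r t) (cvgM (cvg_cst _) (h m.+1))).
elim: n => [|n IH]; first by rewrite expr0; exact: cvg_cst.
rewrite exprS (_ : (fun x => _) = fun x => (circle_path a r x - z)^-1 *
  (circle_path a r x - z)^-1 ^+ n); first exact: (cvgM ic IH).
by apply/funext => x; rewrite exprS.
Qed.

Lemma normc_pole_circle (m : nat) (a z : C) (r : R) t : nc (z - a) < r ->
  nc (circle_speed r t * pole m (circle_path a r t - z)) <=
    r * (m`!%:R * (r - nc (z - a))^-1 ^+ m.+1).
Proof.
move=> za; have r0 : 0 < r by exact: le_lt_trans (normc_ge0 _) za.
rewrite Normc.normcM normc_circle_speed ?(ltW r0)// ler_pM2l//.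
apply: normc_pole; last exact: normc_inv_circle_path.
by rewrite invr_ge0 subr_ge0 ltW.
Qed.

Lemma bounded_measurable_torus_kernel (m : 'I_d -> nat) (z : Cd) : P z ->
  bounded_measurable [set: d.-tuple RM] (torus_kernel m z).
Proof.
move=> /polydiscP Pz; apply: bounded_measurable_prod => // k.
apply: (@bounded_measurable_coord R d k
  (fun t => circle_speed (rho k) t * pole (m k) (circle_path (w 0 k) (rho k) t - z 0 k))
  (rho k * ((m k)`!%:R * (rho k - nc (z 0 k - w 0 k))^-1 ^+ (m k).+1))).
  exact: pole_circle_continuous (Pz k).
by move=> t; exact: normc_pole_circle (Pz k).
Qed.

(** Only the j-th factor depends on h.  For |h| at most half the distance delta
from z_j to the circle, both poles stay at distance at least delta / 2 from
it, so the error is uniform in t. *)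
Lemma torus_kernel_quotient (m : 'I_d -> nat) (j : 'I_d) (z : Cd) : P z ->
  exists e K : R, [/\ 0 < e, 0 <= K,
    forall h : C, nc h < e -> P (z + h *: delta_mx 0 j) &
    forall (h : C) t, h != 0 -> nc h < e ->
      nc (h^-1 * (torus_kernel m (z + h *: delta_mx 0 j) t - torus_kernel m z t) -
          torus_kernel (mindex_succ m j) z t) <= K * nc h ].
Proof.
move=> /polydiscP Pz; set delta := rho j - nc (z 0 j - w 0 j).
have delta0 : 0 < delta by rewrite subr_gt0.
have d20 : 0 < delta / 2 by rewrite divr_gt0.
pose M := (delta / 2)^-1; have M0 : 0 <= M by rewrite invr_ge0 ltW.
have [K K0 KP] := pole_quotient (m j) M0.
pose B := \prod_(k < d | k != j) (rho k * ((m k)`!%:R * (rho k - nc (z 0 k - w 0 k))^-1 ^+ (m k).+1)).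
have rho0 k : 0 < rho k by exact: le_lt_trans (normc_ge0 _) (Pz k).
have B0 : 0 <= B.
  apply: prodr_ge0 => k _; rewrite !mulr_ge0// ?exprn_ge0 ?invr_ge0 ?subr_ge0 ?ltW//.
have zjh h k : (z + h *: delta_mx 0 j) 0 k = z 0 k + h * (k == j)%:R.
  by rewrite !mxE eqxx.
have near_z h : nc h < delta / 2 -> nc (z 0 j + h - w 0 j) < rho j - delta / 2.
  move=> hd; have := le_normcD (z 0 j - w 0 j) h.
  by rewrite addrAC /delta; move: hd; rewrite /delta; lra.
exists (delta / 2), (rho j * (K * B)); split => //.
- by rewrite !mulr_ge0// ltW.
- move=> h hd; apply/polydiscP => k; rewrite zjh; case: eqP => [->|_].
    by rewrite mulr1; have := near_z h hd; lra.
  by rewrite mulr0 addr0.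
move=> h t h0 hd.
pose c k := circle_path (w 0 k) (rho k) (tnth t k).
pose A := \prod_(k < d | k != j) (circle_speed (rho k) (tnth t k) * pole (m k) (c k - z 0 k)).
have AB : nc A <= B.
  rewrite /A /B; elim/big_rec2: _ => [|k x y kj xy]; first by rewrite Normc.normc1.
  by rewrite Normc.normcM ler_pM ?normc_ge0//; exact: normc_pole_circle (Pz k).
have E1 : torus_kernel m z t = circle_speed (rho j) (tnth t j) * pole (m j) (c j - z 0 j) * A.
  by rewrite /torus_kernel (bigD1 j).
have E2 : torus_kernel m (z + h *: delta_mx 0 j) t =
    circle_speed (rho j) (tnth t j) * pole (m j) (c j - z 0 j - h) * A.
  rewrite /torus_kernel (bigD1 j isT) zjh eqxx mulr1 opprD addrA.
  congr (_ * _); apply: eq_bigr => k kj.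
  by rewrite zjh (negPf kj) mulr0 addr0.
have E3 : torus_kernel (mindex_succ m j) z t =
    circle_speed (rho j) (tnth t j) * pole (m j).+1 (c j - z 0 j) * A.
  rewrite /torus_kernel (bigD1 j isT) /mindex_succ eqxx addn1.
  congr (_ * _); apply: eq_bigr => k kj.
  by rewrite (negPf kj) addn0.
rewrite E1 E2 E3.
have -> : h^-1 * (circle_speed (rho j) (tnth t j) * pole (m j) (c j - z 0 j - h) * A -
      circle_speed (rho j) (tnth t j) * pole (m j) (c j - z 0 j) * A) -
    circle_speed (rho j) (tnth t j) * pole (m j).+1 (c j - z 0 j) * A =
    circle_speed (rho j) (tnth t j) * ((h^-1 * (pole (m j) (c j - z 0 j - h) -
      pole (m j) (c j - z 0 j)) - pole (m j).+1 (c j - z 0 j)) * A) by ring.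
rewrite Normc.normcM normc_circle_speed ?(ltW (rho0 j))// -mulrA ler_pM2l//.
rewrite Normc.normcM mulrAC ler_pM ?normc_ge0//.
have inv_le y : delta / 2 <= nc y -> y != 0 /\ nc y^-1 <= M.
  move=> yd; have y0 : 0 < nc y by exact: lt_le_trans yd.
  by rewrite -normc_gt0 y0 Normc.normcV lef_pV2.
have cz : delta <= nc (c j - z 0 j) by exact: circle_path_dist (Pz j) _.
have [|x0 xM] := inv_le (c j - z 0 j); first by lra.
have [|xh0 xhM] := inv_le (c j - z 0 j - h).
  have := le_normcD (c j - z 0 j - h) h; rewrite subrK; lra.
exact: KP.
Qed.

End TorusKernel.

(** * Cauchy's formula for derivatives *)

Section CauchyFormula.
Context {R : realType} {d : nat} {E F : tvsType R[i]} {iota : {linear E -> F}}.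
Local Notation C := R[i].
Local Notation nc := (@Normc.normc R).
Local Notation Cd := 'rV[C]_d.
Local Notation RM := (measurableTypeR R).
Local Notation box := (@period_box R d).
Local Notation mu := (@lebesgue_tuple R d).
Local Notation twopii := (2 * pi%:C * (0 +i* 1) : C).
Variables (Omega : set Cd) (f : Cd -> E).
Hypotheses (E_hausdorff : hausdorff_space E) (E_lc : locally_complete E).
Hypotheses (Omega_open : open Omega) (iota_emb : tvs_embedding iota)
  (f_holo : holomorphic iota Omega f).
Variables (w : Cd) (rho rho' : 'I_d -> R).
Hypotheses (rho_gt0 : forall k, 0 < rho k) (rho_lt : forall k, rho k < rho' k)
  (rho'_sub : closed_polydisc w rho' `<=` Omega).

Local Notation P := (polydisc w (EFin \o rho)).

Lemma torus_pathE (t : d.-tuple R) :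
  torus_path w rho t = \row_k tnth (torus_pt (fun k => w 0 k) rho t) k.
Proof. by apply/rowP => k; rewrite !mxE tnth_mktuple. Qed.

Lemma torus_path_closed_polydisc t : closed_polydisc w rho' (torus_path w rho t).
Proof.
move=> k; rewrite mxE normc_circle_path ?(ltW (rho_gt0 k))//; exact: ltW.
Qed.

Lemma torus_image_bounded : tvs_bounded [set f (torus_path w rho t) | t in setT].
Proof.
have bK := @compact_bounded_tvs R _ E _ f (@compact_closed_polydisc R d w rho')
  (fun z Kz => holomorphic_continuous Omega_open iota_emb f_holo (rho'_sub Kz)).
move=> U U0; have [r r0 fU] := bK U U0; exists r => // _ [t _ <-]; apply: fU.
by exists (torus_path w rho t) => //; exact: torus_path_closed_polydisc.
Qed.

Lemma bounded_measurable_trace (phi : {scalar E}) : continuous phi ->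
  bounded_measurable [set: d.-tuple RM] (fun t => phi (f (torus_path w rho t))).
Proof.
move=> cphi; have := @bounded_measurable_torus R d _ rho rho' _ (fun k => ltW (rho_gt0 k)) rho_lt
  (weakly_separately_holomorphic Omega_open iota_emb f_holo cphi rho'_sub).
by congr bounded_measurable; apply/funext => t; rewrite torus_pathE.
Qed.

Definition cauchy_integral (m : 'I_d -> nat) (phi : {scalar E}) (z : Cd) : C :=
  cintegral mu box (fun t => torus_kernel w rho m z t * phi (f (torus_path w rho t))).

Lemma bounded_measurable_integrand (m : 'I_d -> nat) (phi : {scalar E}) (z : Cd) :
  continuous phi -> P z ->
  bounded_measurable box (fun t => torus_kernel w rho m z t * phi (f (torus_path w rho t))).
Proof.
move=> cphi Pz; apply: bounded_measurableT; apply: bounded_measurableM.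
  exact: bounded_measurable_torus_kernel.
exact: bounded_measurable_trace.
Qed.

(** The strictly larger radii rho' leave around the torus the room in which the
homotopies behind the scalar formula move. *)
Lemma cauchy_formula (phi : {scalar E}) (z : Cd) : continuous phi -> P z ->
  twopii ^+ d * phi (f z) = cauchy_integral (fun=> 0%N) phi z.
Proof.
move=> cphi /polydiscP Pz; pose z' := [tuple z 0 k | k < d].
have z'E k : tnth z' k = z 0 k by rewrite tnth_mktuple.
have z'P : tuple_polydisc (fun k => w 0 k) rho z' by move=> k; rewrite z'E.
have := @cauchy_polydisc R d _ rho rho' z' _ z'P rho_lt
  (weakly_separately_holomorphic Omega_open iota_emb f_holo cphi rho'_sub).
have -> : \row_k tnth z' k = z by apply/rowP => k; rewrite mxE z'E.
move=> <-; rewrite /cauchy_integral; apply: eq_cintegral => t _.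
rewrite torus_pathE; congr (_ * _); apply: eq_bigr => k _.
by rewrite /cauchy_kernel /pole z'E mul1r expr1.
Qed.

Definition torus_volume : R := 2 * fine (mu box).

Lemma normc_cauchy_integral (k : d.-tuple R -> C) (phi : {scalar E}) (B c : R) :
  continuous phi -> 0 <= B ->
  bounded_measurable [set: d.-tuple RM] k ->
  (forall t, nc (k t) <= B) -> (forall t, nc (phi (f (torus_path w rho t))) <= c) ->
  nc (cintegral mu box (fun t => k t * phi (f (torus_path w rho t)))) <= torus_volume * B * c.
Proof.
move=> cphi B0 bk kB phic.
have -> : torus_volume * B * c = 2 * (B * c) * fine (mu box) by rewrite /torus_volume; ring.
apply: normc_cintegral.
- exact: measurable_period_box.
- exact: period_box_ltoo.
- by apply: bounded_measurableT; apply: bounded_measurableM => //; exact: bounded_measurable_trace.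
- by move=> t _; rewrite Normc.normcM ler_pM ?normc_ge0.
Qed.

Lemma twopii_neq0 : twopii != 0.
Proof.
apply: mulf_neq0; first apply: mulf_neq0.
- by rewrite pnatr_eq0.
- by rewrite (inj_eq (@complexI _)) gt_eqF ?pi_gt0.
- by rewrite eq_complex/= oner_eq0 andbF.
Qed.

(** Subtracting the integral with the differentiated kernel from the one that
represents phi (Q h) leaves an integral against the error kq h of the kernel
quotient, of size K |h|.  The bounds are linear in the bound c of phi on
f(torus), with constants independent of phi, as [mackey_limit] requires.
The limit satisfies the new formula because phi is continuous. *)
Lemma cauchy_formula_cpartial (g : Cd -> E) (m : 'I_d -> nat) (j : 'I_d) :
  (forall (phi : {scalar E}) z, continuous phi -> P z ->
     twopii ^+ d * phi (g z) = cauchy_integral m phi z) ->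
  forall z, P z -> (exists l, is_cpartial g j z l) /\
    forall phi : {scalar E}, continuous phi ->
      twopii ^+ d * phi (cpartial g j z) = cauchy_integral (mindex_succ m j) phi z.
Proof.
move=> gm z Pz; set N := twopii ^+ d.
have N0 : N != 0 by rewrite expf_neq0 ?twopii_neq0.
have nN : 0 < nc N by rewrite normc_gt0.
have [e [K [e0 K0 Pe KP]]] := torus_kernel_quotient m j Pz.
have bS := bounded_measurable_torus_kernel (mindex_succ m j) Pz.
have [_ _ [B BP]] := bS.
have B0 : 0 <= B by apply: le_trans (normc_ge0 _) (BP [tuple 0 | k < d] I).
pose Q h := h^-1 *: (g (z + h *: delta_mx 0 j) - g z).
have vol0 : 0 <= torus_volume by rewrite mulr_ge0// fine_ge0.
pose kq h t := h^-1 * (torus_kernel w rho m (z + h *: delta_mx 0 j) t - torus_kernel w rho m z t) -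
          torus_kernel w rho (mindex_succ m j) z t.
have bkq h : nc h < e -> bounded_measurable [set: d.-tuple RM] (kq h).
  move=> he; apply: bounded_measurableB => //; apply: bounded_measurableM.
    exact: bounded_measurable_cst.
  by apply: bounded_measurableB; apply: bounded_measurable_torus_kernel => //; exact: Pe.
have QE h (phi : {scalar E}) : nc h < e -> continuous phi ->
    N * phi (Q h) - cauchy_integral (mindex_succ m j) phi z =
    cintegral mu box (fun t => kq h t * phi (f (torus_path w rho t))).
  move=> he cphi; rewrite /Q linearZ linearB mulrCA mulrBr !gm//; last exact: Pe.
  have mb := @measurable_period_box R d; have bl := @period_box_ltoo R d.
  have bI := bounded_measurable_integrand.
  rewrite /cauchy_integral -cintegralB//; [|apply: bI => //; exact: Pe|exact: bI].
  rewrite -cintegralZ//; last first.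
    by apply: bounded_measurableB => //; apply: bI => //; exact: Pe.
  rewrite -cintegralB//.
  - by apply: eq_cintegral => t _; rewrite /kq; ring.
  - apply: bounded_measurableM => //; first exact: bounded_measurable_cst.
    by apply: bounded_measurableB => //; apply: bI => //; exact: Pe.
  - exact: bI.
pose K1 := torus_volume * K / nc N.
have K10 : 0 <= K1 by apply: divr_ge0; [exact: mulr_ge0|exact: ltW].
have QX h (phi : {scalar E}) (c : R) : h != 0 -> nc h < e -> continuous phi ->
    (forall b, [set f (torus_path w rho t) | t in setT] b -> nc (phi b) <= c) ->
    nc (phi (Q h) - N^-1 * cauchy_integral (mindex_succ m j) phi z) <= K1 * nc h * c.
  move=> h0 he cphi phic.
  have -> : phi (Q h) - N^-1 * cauchy_integral (mindex_succ m j) phi z =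
      N^-1 * (N * phi (Q h) - cauchy_integral (mindex_succ m j) phi z).
    by rewrite mulrBr mulKf.
  rewrite QE// Normc.normcM Normc.normcV ler_pdivrMl//.
  have -> : nc N * (K1 * nc h * c) = torus_volume * (K * nc h) * c.
    by rewrite /K1; field; rewrite gt_eqF.
  apply: normc_cauchy_integral => //.
  - by rewrite mulr_ge0// normc_ge0.
  - exact: bkq.
  - by move=> t; exact: KP.
  - by move=> t; apply: phic; exists t.
have Xle (phi : {scalar E}) (c : R) : continuous phi ->
    (forall b, [set f (torus_path w rho t) | t in setT] b -> nc (phi b) <= c) ->
    nc (N^-1 * cauchy_integral (mindex_succ m j) phi z) <= torus_volume * B / nc N * c.
  move=> cphi phic; rewrite Normc.normcM Normc.normcV ler_pdivrMl//.
  have -> : nc N * (torus_volume * B / nc N * c) = torus_volume * B * c.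
    by field; rewrite gt_eqF.
  apply: normc_cauchy_integral => //.
  - by move=> t; exact: BP.
  - by move=> t; apply: phic; exists t.
(* the first two terms bound phi (Q h), the third the differences, and 1 gives K2 > 0 *)
pose K2 := K1 * e + torus_volume * B / nc N + K1 + 1.
have VB : 0 <= torus_volume * B / nc N by apply: divr_ge0; [exact: mulr_ge0|exact: ltW].
have K1e : 0 <= K1 * e by rewrite mulr_ge0// ltW.
have [|||l Ql] := @mackey_limit R E _ Q e K2 E_lc torus_image_bounded e0.
- by rewrite /K2; lra.
- move=> h phi c h0 he cphi c0 phic.
  have := le_normcD (phi (Q h) - N^-1 * cauchy_integral (mindex_succ m j) phi z)
    (N^-1 * cauchy_integral (mindex_succ m j) phi z).
  rewrite subrK => h1; apply: le_trans h1 _.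
  have h2 := QX h phi c h0 he cphi phic; have h3 := Xle phi c cphi phic.
  have h4 : K1 * nc h * c <= K1 * e * c by rewrite ler_wpM2r// ler_wpM2l// ltW.
  have h5 : 0 <= (K1 + 1) * c by rewrite mulr_ge0// addr_ge0.
  rewrite /K2 !mulrDl; rewrite mulrDl in h5; lra.
- move=> h k phi c h0 he k0 ke cphi c0 phic; rewrite linearB.
  have h2 := QX h phi c h0 he cphi phic; have h3 := QX k phi c k0 ke cphi phic.
  set X := N^-1 * cauchy_integral (mindex_succ m j) phi z in h2 h3.
  have -> : phi (Q h) - phi (Q k) = (phi (Q h) - X) - (phi (Q k) - X) by ring.
  apply: le_trans (le_normcB _ _) _; apply: le_trans (lerD h2 h3) _.
  have -> : K1 * nc h * c + K1 * nc k * c = K1 * ((nc h + nc k) * c) by ring.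
  rewrite -mulrA ler_wpM2r ?mulr_ge0 ?addr_ge0 ?normc_ge0//.
  by rewrite /K2; lra.
have lE : is_cpartial g j z l by [].
have cpE : cpartial g j z = l.
  rewrite /cpartial; case: xgetP => [l' -> l'P|/(_ l)//].
  exact: (cvg_unique E_hausdorff l'P lE).
split; first by exists l.
move=> phi cphi; rewrite cpE.
suff -> : phi l = N^-1 * cauchy_integral (mindex_succ m j) phi z by rewrite mulVKf.
have [_ _ [c0 c0P]] := bounded_measurable_trace cphi.
pose c := Num.max c0 0.
have phic b : [set f (torus_path w rho t) | t in setT] b -> nc (phi b) <= c.
  by move=> [t _ <-]; rewrite le_max c0P.
have phiQ : phi (Q h) @[h --> (0 : C)^'] --> phi l.
  exact: (cvg_comp Q phi Ql (cphi l)).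
apply/eqP; rewrite -subr_eq0 -normc_eq0; apply/eqP/le_anti; rewrite normc_ge0 andbT.
apply/ler_addgt0Pr => eta eta0; rewrite add0r.
have c0' : 0 <= c by rewrite le_max lexx orbT.
pose X := N^-1 * cauchy_integral (mindex_succ m j) phi z.
apply: (@normc_lim_le R (fun h => phi (Q h)) (fun=> X) (phi l) X eta phiQ); first exact: cvg_cst.
apply/dnbhs_normcP; exists (Num.min e (eta / (K1 * c + 1))).
  by rewrite lt_min e0 divr_gt0// ltr_wpDl// mulr_ge0.
move=> h h0; rewrite lt_min => /andP[he heta].
apply: le_trans (QX h phi c h0 he cphi phic) _.
have Kc0 : 0 < K1 * c + 1 by rewrite ltr_wpDl// mulr_ge0.
move: heta; rewrite ltr_pdivlMr// mulrDr mulr1 => heta.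
rewrite mulrAC mulrC; have := normc_ge0 h; lra.
Qed.

Lemma cauchy_formula_cpartials (s : seq 'I_d) :
  cpartials_exist f s P /\
  forall (phi : {scalar E}) z, continuous phi -> P z ->
    twopii ^+ d * phi (cpartials f s z) = cauchy_integral (fun k => count_mem k s) phi z.
Proof.
elim: s => [|j s [IHe IH]].
  by split => // phi z cphi Pz; exact: cauchy_formula.
have step := cauchy_formula_cpartial j IH.
split.
  by split => // z Pz; have [] := step z Pz.
have cntE : (fun k => count_mem k (j :: s)) = mindex_succ (fun k => count_mem k s) j.
  by apply/funext => k; rewrite /= /mindex_succ addnC eq_sym.
by move=> phi z cphi Pz; rewrite cntE; have [_] := step z Pz; exact.
Qed.

End CauchyFormula.

(** * Multi-indices and the Pettis integral *)

Lemma count_mindex_dirs d (beta : 'I_d -> nat) (k : 'I_d) :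
  count_mem k (mindex_dirs beta) = beta k.
Proof.
rewrite /mindex_dirs count_flatten -map_comp sumnE big_map big_enum/= (bigD1 k)//= big1.
  by rewrite count_nseq/= eqxx mul1n addn0.
by move=> j /negPf jk; rewrite count_nseq/= jk mul0n.
Qed.

Lemma torus_kernelE (R : realType) d (w zeta : 'rV[R[i]]_d) (rho : 'I_d -> R)
    (beta : 'I_d -> nat) (t : d.-tuple R) :
  torus_kernel w rho beta zeta t = (\prod_(k < d) (beta k)`!)%:R *
    ((\prod_(k < d) cderive1 (circle_path (w 0 k) (rho k)) (tnth t k)) *
     (mpower (torus_path w rho t - zeta) (fun k => (beta k + 1)%N))^-1).
Proof.
rewrite /torus_kernel /mpower natr_prod -prodfV -!big_split/=.
apply: eq_bigr => k _; rewrite cderive1_circle_path /pole !mxE addn1 exprVn.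
by rewrite mulrCA.
Qed.

Theorem theorem5p1 (R : realType) (d : nat) (d_gt0 : (0 < d)%N)
    (E Ehat : tvsType R[i]) (iota : {linear E -> Ehat})
    (E_neq0 : exists x : E, x != 0)
    (E_hausdorff : hausdorff_space E)
    (E_loc_complete : locally_complete E)
    (iota_completion : is_completion iota)
    (Omega : set 'rV[R[i]]_d) (Omega_open : open Omega)
    (w : 'rV[R[i]]_d) (Omega_w : Omega w)
    (r : 'I_d -> \bar R) (r_gt0 : forall k, (0 < r k)%E)
    (r_sub : polydisc w r `<=` Omega)
    (f : 'rV[R[i]]_d -> E) (f_holo : holomorphic iota Omega f)
    (rho : 'I_d -> R) (rho_gt0 : forall k, 0 < rho k)
    (rho_lt : forall k, ((rho k)%:E < r k)%E)
    (beta : 'I_d -> nat) :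
  cderiv_exists beta f (polydisc w (EFin \o rho)) /\
  forall zeta : 'rV[R[i]]_d, polydisc w (EFin \o rho) zeta ->
    exists2 I : E,
      is_torus_integral w rho
        (fun z => (mpower (z - zeta) (fun k => (beta k + 1)%N))^-1 *: f z) I &
      cderiv beta f zeta =
        ((\prod_(k < d) (beta k)`!)%:R / (2 * pi%:C * (0 +i* 1)) ^+ d) *: I.
Proof.
(* radii rho < rho' < r, with room for f around the closed polydisc of radii rho *)
have ex_between k : exists s : R, rho k < s /\ (s%:E < r k)%E.
  move: (rho_lt k); case: (r k) => [x| |]//; rewrite ?lte_fin => rx.
    by exists ((rho k + x) / 2); rewrite lte_fin; split; lra.
  by exists (rho k + 1); rewrite ltry; split=> //; lra.
have [rho' rho'P] := choice ex_between.
have rho'_gt k : rho k < rho' k by have [] := rho'P k.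
have rho'_sub : closed_polydisc w rho' `<=` Omega.
  move=> z zw; apply: r_sub => k; have [_ h] := rho'P k.
  by apply: le_lt_trans h; rewrite lee_fin; exact: zw.
have [_ _ iota_emb _] := iota_completion.
have [cex cform] := cauchy_formula_cpartials E_hausdorff E_loc_complete Omega_open
  iota_emb f_holo rho_gt0 rho'_gt rho'_sub (mindex_dirs beta).
split; first exact: cex.
move=> zeta zetaP; set N := _ ^+ d; set b := _%:R.
have N0 : N != 0 by rewrite expf_neq0// twopii_neq0.
have b0 : b != 0.
  by rewrite pnatr_eq0 -lt0n prodn_gt0// => k; exact: fact_gt0.
(* the only candidate, as the second claim determines the integral *)
exists ((b / N)^-1 *: cderiv beta f zeta); last first.
  by rewrite scalerA divff ?scale1r// mulf_neq0// invr_eq0.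
move=> phi cphi.
have bI := bounded_measurable_integrand Omega_open iota_emb f_holo rho_gt0 rho'_gt rho'_sub
  beta cphi zetaP.
have integrandE : phi \o (fun t : d.-tuple R =>
    (\prod_(k < d) cderive1 (circle_path (w 0 k) (rho k)) (tnth t k)) *:
    ((mpower (torus_path w rho t - zeta) (fun k => (beta k + 1)%N))^-1 *:
       f (torus_path w rho t))) =
    fun t => b^-1 * (torus_kernel w rho beta zeta t * phi (f (torus_path w rho t))).
  apply/funext => t /=; rewrite torus_kernelE -/b !mulrA mulVf// mul1r.
  by rewrite !linearZ/= mulrA.
rewrite integrandE.
have mbox := @measurable_period_box R d; have boxoo := @period_box_ltoo R d.
split.
  apply: (bounded_measurable_cintegrable mbox boxoo).
  by apply: bounded_measurableM => //; exact: bounded_measurable_cst.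
have := cform phi zeta cphi zetaP; rewrite -/N.
have -> : (fun k => count_mem k (mindex_dirs beta)) = beta.
  by apply/funext => k; exact: count_mindex_dirs.
move=> cf; rewrite (cintegralZ mbox boxoo _ bI) -[cintegral _ _ _]/(cauchy_integral f w rho beta phi zeta).
by rewrite -cf linearZ/= invfM invrK mulrA.
Qed.
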